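(* For all integers $k\ge 1$ there is a formula $$\pi=\sum_{n=0}^{\infty}\frac{S_k(n)}{\binom{8kn}{4kn}(-4)^{kn}},$$ where $S_k(n)$ is a polynomial in $n$ of degree $4k$ with rational coefficients. The polynomial $S_k(n)$ can be found by solving the system of linear equations $(\mathcal L_k)$ described in the context.
   Context: The system $(\mathcal L_k)$ of linear equations is the following. Fix $k\ge1$ and put $N(k)=4k(4k+1)$. The unknowns are $a(1),a(2),\dots,a(N(k)+4k)$. Put $$\check R(t)=\sum_{j=1}^{N(k)-1}a(j)\,t^j,\qquad S_k(n)=\sum_{j=0}^{4k}a(N(k)+j)\,n^j,\qquad Q(t)=t^{4k}-(-4)^k .$$ Let $P(t)$ be the polynomial in $t$ (with coefficients depending linearly on the unknowns) defined by $$\sum_{n=0}^{\infty}(8kn+1)\,S_k(n)\left(\frac{t^{4k}}{(-4)^k}\right)^{n}=\frac{P(t)}{Q(t)^{4k+2}} .$$ The system $(\mathcal L_k)$ consists of the $N(k)+4k$ linear equations in the unknowns obtained by comparing the coefficients of the powers of $t$ on both sides of the polynomial identity $$-(1-4t)\,Q\,\frac{d\check R}{dt}+\bigl(2Q+4k(4k+1)(1-4t)t^{4k-1}\bigr)\check R-P+2(3-2t)\frac{Q^{4k+2}}{t^2-2t+2}=0 .$$ (Here $t^2-2t+2$ divides $Q(t)$, so that the last term is a polynomial in $t$.) *)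

(* Defs.v *)
(* MathComp / MathComp-Analysis *)
From mathcomp Require Import all_boot all_order all_algebra.
Set Implicit Arguments.
Unset Strict Implicit.
Unset Printing Implicit Defensive.
Import Order.TTheory GRing.Theory Num.Theory.
Local Open Scope ring_scope.

Definition Nk (k : nat) : nat := (4 * k * (4 * k + 1))%N.

(* The unknowns a(1), ..., a(N(k)+4k) form a tuple, which is indexed from 0. *)
Definition unknowns (k : nat) : Type := (Nk k + 4 * k).-tuple rat.

Definition unknown (k : nat) (a : unknowns k) (j : nat) : rat := a`_j.-1.

Definition Rcheck (k : nat) (a : unknowns k) : {poly rat} :=
  \sum_(1 <= j < Nk k) unknown a j *: 'X^j.

Definition Spoly (k : nat) (a : unknowns k) : {poly rat} :=
  \sum_(0 <= j < (4 * k).+1) unknown a (Nk k + j) *: 'X^j.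

Definition Qpoly (k : nat) : {poly rat} := 'X^(4 * k) - ((- 4) ^+ k)%:P.

(* Coefficient of t^(4kn) in sum_n (8kn+1) S_k(n) (t^(4k)/(-4)^k)^n. *)
Definition gen_coef (k : nat) (a : unknowns k) (n : nat) : rat :=
  (8 * k * n + 1)%:R * (Spoly a).[n%:R] / ((- 4) ^+ k) ^+ n.

(* sum_n (8kn+1) S_k(n) (t^(4k)/(-4)^k)^n = P(t) / Q(t)^(4k+2), as an identity
   of formal power series in t with the denominator cleared (Q(0) <> 0).  For
   k >= 1 the terms with n > m do not contribute to the coefficient of t^m,
   hence the truncation of the series; P is then determined by a. *)
Definition is_numerator (k : nat) (a : unknowns k) (P : {poly rat}) : Prop :=
  forall m : nat,
    (Qpoly k ^+ (4 * k + 2)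
       * \sum_(0 <= n < m.+1) gen_coef a n *: 'X^(4 * k * n))`_m = P`_m.

(* The division by 'X^2 - 2 'X + 2 is exact for k >= 1. *)
Definition system_lhs (k : nat) (a : unknowns k) (P : {poly rat}) : {poly rat} :=
  - (1 - 4 *: 'X) * Qpoly k * (Rcheck a)^`()
  + (2 *: Qpoly k
     + (4 * k * (4 * k + 1))%:R *: ((1 - 4 *: 'X) * 'X^(4 * k - 1))) * Rcheck a
  - P
  + 2 *: (3%:P - 2 *: 'X)
      * (Qpoly k ^+ (4 * k + 2) %/ ('X^2 - 2 *: 'X + 2%:P)).

(* The system (L_k).  All coefficients of system_lhs in degree N(k) + 4k or
   more vanish identically, so these N(k) + 4k equations express that
   system_lhs is the zero polynomial. *)
Definition solves_L (k : nat) (a : unknowns k) : Prop :=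
  exists2 P : {poly rat}, is_numerator a P &
    forall m : 'I_(Nk k + 4 * k), (system_lhs a P)`_m = 0.

(* Main.v *)
From HB Require Import structures.
Require Import Defs.
From mathcomp Require Import all_boot all_order all_algebra.
From mathcomp Require Import all_classical all_reals all_analysis.
From mathcomp Require Import ring lra zify.
Set Implicit Arguments.
Unset Strict Implicit.
Unset Printing Implicit Defensive.
Import Order.TTheory GRing.Theory Num.Theory.
Import numFieldNormedType.Exports.
Local Open Scope classical_set_scope.
Local Open Scope ring_scope.

(** Notation: M = 4k, q = (-4)^k, t = x(1-x), Q = t^M - q, I_n is the integral
    of t^n for x in [0,1], that is I_n = 1/((2n+1) C(2n,n)), and F_n are the
    Taylor coefficients of F(t) = 2(3-2t)/(t^2-2t+2).

    Value of the series.  For t = x(1-x) one has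
    F(t) = 2/(1+x^2) + 2/(1+(1-x)^2), whose integral over [0,1] is pi, so that
    pi is the sum of the F_n I_n ([pi_series_bound]).  Write R = Q^(M+1) U for the
    first part R of the unknowns.  The polynomial identity of the system then
    reads (1-4t) U' - 2U = F - p, where p is the sum of the p_n t^n and
    p_(Mj) = (2Mj+1) S(j) q^-j, all other p_n being 0.  On coefficients this is
    (n+1) u_(n+1) = (4n+2) u_n + F_n - p_n ([coef_recurrence]), and division by
    (n+1) C(2n+2,n+1) = 2(2n+1) C(2n,n) makes u_n / C(2n,n) telescope: the sum
    of S(j) / (C(2Mj,Mj) q^j) differs from that of F_n I_n by a multiple of
    u_n / C(2n,n), which tends to 0 ([telescoping], [sol_coef_bound]).

    Unique solvability.  The system has as many equations as unknowns, so it is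
    enough that its homogeneous version has only the zero solution.  Since R has
    degree less than M(M+1), the coefficients of U = R / Q^(M+1) have the form
    u_(Mj+i) = q^-j g_i(j) for 1 <= i <= M, with polynomials g_i of degree at
    most M, and g_M(-1) = 0 ([residue_polyE], [residue_poly_last]).  The
    recurrence becomes a chain of polynomial identities between the g_i, which
    may be evaluated at any argument.  At the index n = -1/2 the factor 4n+2
    vanishes and the chain starts from scratch: with G_i(r) denoting g_i at the
    index n = r + 1/2, it reads (r + 1/2) G_(i+1)(r) = 4r G_i(r-1) + F_i, so that
    G_i(0), ..., G_i(i-1) are determined by the F_n alone.  In the homogeneous
    case they are 0, hence g_M has M zeros besides -1 and vanishes, and then so
    does everything else ([homogeneous_eq0]).

    Degree.  If S had degree less than M, comparison of the leading coefficients
    along the cycle of identities would force deg g_M < M ([top_coef_last]), so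
    g_M would be known from G_M(0), ..., G_M(M-1).  In the Newton basis these
    values are explicit ([g_node]):
    G_M(r) = (2/q) sum_m (-1)^m C(r,m) 4^m I_m c_m, where c_0 = 4, c_1 = -4 and
    c_(m+2) = -6 c_(m+1) - 25 c_m.  As C(-1/2,m) = (-1/4)^m C(2m,m), the equation
    g_M(-1) = G_M(-1/2) = 0 would become: the sum of c_m/(2m+1) over m < M is 0.
    No c_m is divisible by 3, and among 1, 3, ..., 2M-1 exactly one number has
    the largest power of 3, so this sum is not 0 ([sum_odd_inv_neq0],
    [size_S_gt]). *)

(** * Products of polynomials with formal power series *)

Section PowerSeries.
Variable K : fieldType.
Implicit Types (A B : {poly K}) (u v : nat -> K).

(** The coefficients of the product of A with the power series whose n-th
    coefficient is u n. *)
Definition conv A u (n : nat) : K := \sum_(i < n.+1) A`_i * u (n - i)%N.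

(** Truncation turns products with series into products of polynomials, from
    which associativity and the Leibniz rule are inherited. *)
Lemma conv_trunc A u n L : (n < L)%N ->
  conv A u n = (A * \poly_(i < L) u i)`_n.
Proof.
move=> ltnL; rewrite coefM; apply: eq_bigr => i _.
by rewrite coef_poly (leq_ltn_trans (leq_subr _ _) ltnL).
Qed.

Lemma eq_conv A u v n : (forall m, (m <= n)%N -> u m = v m) ->
  conv A u n = conv A v n.
Proof. by move=> uv; apply: eq_bigr => i _; rewrite uv ?leq_subr. Qed.

Lemma conv_poly A B n : conv A (nth 0 B) n = (A * B)`_n.
Proof. by rewrite coefM. Qed.

Lemma convM A B u n : conv (A * B) u n = conv A (conv B u) n.
Proof.
rewrite (@conv_trunc _ _ _ n.+1) // -mulrA coefM; apply: eq_bigr => i _.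
by rewrite (@conv_trunc _ _ _ n.+1) // ltnS leq_subr.
Qed.

Lemma convC c u n : conv c%:P u n = c * u n.
Proof.
rewrite /conv big_ord_recl coefC subn0 big1 ?addr0 // => i _.
by rewrite coefC mul0r.
Qed.

Lemma convDl A B u n : conv (A + B) u n = conv A u n + conv B u n.
Proof. by rewrite -big_split; apply: eq_bigr => i _; rewrite coefD mulrDl. Qed.

Lemma convDr A u v n : conv A (fun m => u m + v m) n = conv A u n + conv A v n.
Proof. by rewrite -big_split; apply: eq_bigr => i _; rewrite mulrDr. Qed.

Lemma convB A u v n : conv A (fun m => u m - v m) n = conv A u n - conv A v n.
Proof.
by rewrite -sumrB; apply: eq_bigr => i _; rewrite mulrBr.
Qed.

Lemma convZl c A u n : conv (c *: A) u n = c * conv A u n.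
Proof. by rewrite mulr_sumr; apply: eq_bigr => i _; rewrite coefZ mulrA. Qed.

Lemma convZ A c u n : conv A (fun m => c * u m) n = c * conv A u n.
Proof. by rewrite mulr_sumr; apply: eq_bigr => i _; rewrite mulrCA. Qed.

Lemma conv_delta A n : conv A (fun m => (m == 0%N)%:R) n = A`_n.
Proof.
rewrite -[A in RHS]mulr1 -conv_poly; apply: eq_conv => m _.
by rewrite -polyC1 coefC; case: eqP.
Qed.

Lemma convXnC M q u n :
  conv ('X^M - q%:P) u n = (if (n < M)%N then 0 else u (n - M)%N) - q * u n.
Proof.
rewrite (@conv_trunc _ _ _ n.+1) // mulrBl coefB coefXnM coefCM !coef_poly.
by rewrite !ltnS leqnn leq_subr.
Qed.

(** The Leibniz rule: the sequence (m+1) u_(m+1) lists the coefficients of the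
    derivative of the series of u. *)
Lemma conv_deriv A u n :
  conv A u n.+1 *+ n.+1 = conv A^`() u n + conv A (fun m => u m.+1 *+ m.+1) n.
Proof.
rewrite (@conv_trunc _ _ _ n.+2) // -coef_deriv derivM coefD.
rewrite -(@conv_trunc _ _ _ n.+2) //; congr (_ + _).
rewrite coefM; apply: eq_bigr => i _.
by rewrite coef_deriv coef_poly ltnS ltnS leq_subr.
Qed.

(** A polynomial with nonzero constant term is invertible as a power series. *)
Lemma conv_eq0 A u : A`_0 != 0 -> (forall n, conv A u n = 0) ->
  forall n, u n = 0.
Proof.
move=> A0 Au0; elim/ltn_ind=> n IHn.
have := Au0 n; rewrite /conv big_ord_recl big1 => [|i _].
  by rewrite addr0 subn0 => /eqP; rewrite mulf_eq0 (negPf A0) => /eqP.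
by rewrite IHn ?mulr0 // lift0; have := ltn_ord i; lia.
Qed.

(** The coefficients of ('X^M - q)^-(d+1), by the binomial series. *)
Definition inv_pow (M : nat) (q : K) (d n : nat) : K :=
  if (M %| n)%N then
    (- q) ^- d.+1 * q ^- (n %/ M) * 'C(n %/ M + d, d)%:R else 0.

(** Multiplication by one factor 'X^M - q lowers d by one: Pascal's rule. *)
Lemma conv_inv_pow M q d n : (0 < M)%N -> q != 0 ->
  conv (('X^M - q%:P) ^+ d.+1) (inv_pow M q d) n = (n == 0%N)%:R.
Proof.
move=> M0 q0; elim: d => [|d IHd] in n *.
  rewrite expr1 convXnC /inv_pow.
  have [nM|Mn] := ltnP n M.
    case: (posnP n) => [->|n0].
      rewrite dvdn0 div0n bin0 expr1 expr0 /=; field.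
      by rewrite ?oppr_eq0 q0 ?oner_neq0.
    by rewrite gtnNdvd // mulr0 subr0.
  rewrite (_ : (n == 0%N) = false); last by apply/eqP; lia.
  have -> : (M %| n - M)%N = (M %| n)%N by rewrite -[in RHS](subnK Mn) dvdn_addl.
  case: ifP => [/dvdnP[[|j] e]|_]; rewrite ?mulr0 ?subr0 //.
    by move: Mn; rewrite e; lia.
  have -> : (n - M = j * M)%N by rewrite e mulSn addKn.
  rewrite e !mulnK // !bin0 !mulr1 [q ^+ j.+1]exprS expr1 /=; field.
  by rewrite ?expf_neq0 ?oppr_eq0 ?q0.
rewrite exprSr convM -IHd; apply: eq_conv => m _.
rewrite convXnC /inv_pow.
have [mM|Mm] := ltnP m M.
  case: (posnP m) => [->|m0].
    rewrite dvdn0 div0n !add0n !binn !expr0 [(-q) ^+ d.+2]exprS; field.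
    by rewrite ?expf_neq0 ?oppr_eq0 ?oner_eq0 ?q0 ?oner_eq0.
  by rewrite gtnNdvd // mulr0 subr0.
have -> : (M %| m - M)%N = (M %| m)%N by rewrite -[in RHS](subnK Mm) dvdn_addl.
case: ifP => [/dvdnP[[|j] e]|_]; rewrite ?mulr0 ?subr0 //.
  by move: Mm; rewrite e; lia.
have -> : (m - M = j * M)%N by rewrite e mulSn addKn.
rewrite e !mulnK // (addSn j d.+1) (addSn j d) addnS (binS (j + d).+1) natrD.
rewrite [(-q) ^+ d.+2]exprS [q ^+ j.+1]exprS.
by field; rewrite ?expf_neq0 ?oppr_eq0 ?oner_eq0 ?q0 ?oner_eq0.
Qed.

Lemma conv_inv_powK M q d A n : (0 < M)%N -> q != 0 ->
  conv (('X^M - q%:P) ^+ d.+1) (conv A (inv_pow M q d)) n = A`_n.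
Proof.
move=> M0 q0; rewrite -convM mulrC convM -conv_delta.
by apply: eq_conv => m _; rewrite conv_inv_pow.
Qed.

End PowerSeries.

(** * Rational functions with denominator a power of 'X^M - q *)

Section QuasiPolynomials.
Variable K : numFieldType.
Implicit Types (p h R : {poly K}) (q c : K).

Lemma coef_comp_shift p c d : (size p <= d.+1)%N ->
  (p \Po ('X + c%:P))`_d = p`_d.
Proof.
move=> sp; have s2 : size ('X + c%:P) = 2 by rewrite size_XaddC.
have [spd|spd] := leqP (size p) d.
  by rewrite !nth_default // size_comp_poly2.
have {}sp : size p = d.+1 by apply/eqP; rewrite eqn_leq sp.
have := @lead_coef_comp _ p ('X + c%:P); rewrite s2 => /(_ isT).
by rewrite !lead_coefE size_comp_poly2 // sp s2 /= coefD coefX coefC addr0 expr1n mulr1.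
Qed.

Lemma horner_shift p c x : (p \Po ('X + c%:P)).[x] = p.[x + c].
Proof. by rewrite horner_comp hornerD hornerX hornerC. Qed.

Lemma size_comp_shift p c : size (p \Po ('X + c%:P)) = size p.
Proof. by rewrite size_comp_poly2 ?size_XaddC. Qed.

Lemma size_leS p d : (size p <= d.+1)%N -> p`_d = 0 -> (size p <= d)%N.
Proof.
move=> sp pd; apply/leq_sizeP => j; rewrite leq_eqVlt => /predU1P[<- //|].
by move=> dj; rewrite nth_default // (leq_trans sp).
Qed.

Lemma size_shift_diff p c d : (size p <= d.+1)%N ->
  (size (p \Po ('X + c%:P) - p)%R <= d)%N.
Proof.
move=> sp; apply: size_leS; last by rewrite coefB coef_comp_shift // subrr.
by rewrite (leq_trans (size_polyD _ _)) // size_polyN size_comp_shift maxnn.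
Qed.

(** Each factor 'X^M - q acts on q^-j h(j) as a finite difference, which lowers
    the degree of h; d factors annihilate h.  Each of them spoils one more
    initial block of M coefficients, whence the bound j0. *)
Lemma conv_pow_eq0 M q d h j0 (v : nat -> K) : (0 < M)%N -> q != 0 ->
    (size h <= d)%N ->
    (forall n, (M * j0 <= n)%N ->
       v n = if (M %| n)%N then q ^- (n %/ M) * h.[(n %/ M)%:R] else 0) ->
  forall n, (M * (j0 + d) <= n)%N -> conv (('X^M - q%:P) ^+ d) v n = 0.
Proof.
move=> M0 q0; elim: d => [|d IHd] in h j0 v * => sh hv n.
  move: sh; rewrite leqn0 size_poly_eq0 => /eqP h0; rewrite addn0 => jn.
  rewrite expr0 /conv big_ord_recl coefC mul1r subn0 hv // h0 horner0 mulr0 if_same.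
  by rewrite big1 ?addr0 // => i _; rewrite coefC mul0r.
rewrite exprSr convM addnS -addSn => jn.
apply: (IHd (q *: (h \Po ('X + (-1)%:P) - h)) j0.+1) => //.
  by rewrite (leq_trans (size_scale_leq _ _)) ?size_shift_diff.
move=> m; rewrite mulnS => jm; have Mm : (M <= m)%N by lia.
rewrite convXnC ltnNge Mm /= !hv; [|lia|lia].
have -> : (M %| m - M)%N = (M %| m)%N by rewrite -[in RHS](subnK Mm) dvdn_addl.
case: ifP => [/dvdnP[[|j] e]|_]; last by rewrite mulr0 subr0.
  by move: Mm; rewrite e; lia.
have -> : (m - M = j * M)%N by rewrite e mulSn addKn.
rewrite e !mulnK // hornerZ hornerD hornerN horner_shift exprS.
rewrite -[j.+1]addn1 natrD addrK; field.
by rewrite ?expf_neq0 ?q0.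
Qed.

Definition binom_poly d : {poly K} :=
  d`!%:R^-1 *: \prod_(i < d) ('X - (i : nat)%:R%:P).

Lemma size_binom_poly d : (size (binom_poly d) <= d.+1)%N.
Proof.
rewrite (leq_trans (size_scale_leq _ _)) // size_prod_XsubC /index_enum -enumT.
by rewrite size_enum_ord.
Qed.

Lemma binom_polyS d x : (binom_poly d.+1).[x] = (x - d%:R) / d.+1%:R * (binom_poly d).[x].
Proof.
rewrite /binom_poly !hornerZ big_ord_recr hornerM hornerXsubC factS natrM; field.
by rewrite ?natr1 ?nat1r !pnatr_eq0 -?lt0n ?fact_gt0.
Qed.

Lemma binom_poly0 x : (binom_poly 0).[x] = 1.
Proof. by rewrite /binom_poly big_ord0 invr1 scale1r hornerC. Qed.

Lemma binom_poly_nat d n : (binom_poly d).[n%:R] = 'C(n, d)%:R.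
Proof.
elim: d => [|d IHd]; first by rewrite binom_poly0 bin0.
rewrite binom_polyS IHd; have d0 : d.+1%:R != 0 :> K by rewrite pnatr_eq0.
apply: (mulfI d0); rewrite -natrM mul_bin_left mulrA mulrCA divff // mulr1.
have [dn|nd] := leqP d n; first by rewrite natrM natrB.
by rewrite bin_small // muln0 mulr0.
Qed.

Lemma mul_central_bin d :
  (d.+1 * 'C(d.+1.*2, d.+1) = 2 * d.*2.+1 * 'C(d.*2, d))%N.
Proof.
have H1 := mul_bin_diag d.+1.*2 d; have H2 := mul_bin_down d.*2.+1 d.
rewrite doubleS /= in H1 H2 *; rewrite -H1.
have -> : (d.*2.+2 = 2 * d.+1)%N by lia.
rewrite -[in RHS]mulnA H2 mulnA; congr (_ * _)%N; lia.
Qed.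

Lemma central_bin_ge n : (2 ^ n <= 'C(n.*2, n))%N.
Proof.
elim: n => [|n IHn]; first by rewrite bin0.
rewrite -(leq_pmul2l (ltn0Sn n)) mul_central_bin expnS.
by rewrite mulnCA -[leqRHS]mulnA leq_mul2l /= leq_mul // -addnn; lia.
Qed.

Lemma central_binS d : 'C(d.+1.*2, d.+1)%:R =
  2 * (2 * d%:R + 1) / (d%:R + 1) * 'C(d.*2, d)%:R :> K.
Proof.
have d1 : d%:R + 1 != 0 :> K by rewrite natr1 pnatr_eq0.
apply: (mulfI d1); have : (d.+1 * 'C(d.+1.*2, d.+1))%:R =
    (2 * d.*2.+1 * 'C(d.*2, d))%:R :> K.
  by rewrite mul_central_bin.
by rewrite !natrM natr1 => ->; rewrite -!natr1 -mul2n natrM; field.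
Qed.

(** The binomial series of (1-4t)^(-1/2). *)
Lemma binom_poly_half d :
  (binom_poly d).[- 2^-1] = (-1) ^+ d * 'C(d.*2, d)%:R / 4 ^+ d.
Proof.
elim: d => [|d IHd]; first by rewrite binom_poly0 bin0 expr0; field.
rewrite binom_polyS IHd exprS.
rewrite central_binS [4 ^+ d.+1]exprS -natr1; field.
by rewrite expf_neq0 ?pnatr_eq0 // natr1 pnatr_eq0.
Qed.

(** The coefficients of R / ('X^M - q)^(d+1) at the indices M j + i are q^-j
    times a polynomial in j: the monomial of degree s = M l + i contributes
    a shift by l of the binomial polynomial of [inv_pow]. *)
Definition residue_poly M q d R i : {poly K} :=
  \sum_(s < size R | (0 < s)%N && (s == i %[mod M]))
    (R`_s * (- q) ^- d.+1 * q ^+ ((s - i) %/ M)) *: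
    (binom_poly d \Po ('X + (d%:R - ((s - i) %/ M)%:R)%:P)).

Lemma size_residue_poly M q d R i : (size (residue_poly M q d R i) <= d.+1)%N.
Proof.
apply: (leq_trans (size_sum _ _ _)); apply/bigmax_leqP => s _.
by rewrite (leq_trans (size_scale_leq _ _)) // size_comp_shift size_binom_poly.
Qed.

(** The terms with l > j are absent from the product on the left; on the right
    they vanish because l <= d, so that the binomial polynomial is evaluated at
    one of its zeros 0, ..., d-1. *)
Lemma residue_polyE M q d R i j : (0 < M)%N -> q != 0 ->
    R`_0 = 0 -> (size R <= M * d.+1)%N -> (0 < i <= M)%N ->
  conv R (inv_pow M q d) (M * j + i) = q ^- j * (residue_poly M q d R i).[j%:R].
Proof.
move=> M0 q0 R0 sR /andP[i0 iM]; set n := (M * j + i)%N.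
have -> : conv R (inv_pow M q d) n =
    \sum_(s < size R) (if (s <= n)%N then R`_s * inv_pow M q d (n - s) else 0).
  rewrite /conv (big_ord_widen (n.+1 + size R)
    (fun s => R`_s * inv_pow M q d (n - s)%N)) ?leq_addr //.
  rewrite [RHS](big_ord_widen (n.+1 + size R)
    (fun s => if (s <= n)%N then R`_s * inv_pow M q d (n - s)%N else 0)) ?leq_addl //.
  rewrite -[RHS]big_mkcondr; rewrite [LHS]big_mkcond [RHS]big_mkcond.
  apply: eq_bigr => s _; rewrite ltnS andbC.
  case: ifP => //= sn; case: ltnP => // sz; by rewrite nth_default ?mul0r.
rewrite /residue_poly horner_sum mulr_sumr [RHS]big_mkcond.
apply: eq_bigr => s _; case: (posnP s) => [->|s0].
  by rewrite R0 mul0r.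
have nE : (n == i %[mod M])%N by rewrite /n -modnDm modnMr add0n modn_mod.
case: ifP => [sn|sn].
  rewrite /= /inv_pow -(eqn_mod_dvd _ sn) (eqP nE) eq_sym; case: ifP => [si|_].
    have is_ : (i <= s)%N.
      rewrite leqNgt; apply/negP => si'; move: si; rewrite eq_sym eqn_mod_dvd 1?ltnW //.
      by rewrite gtnNdvd //; lia.
    have /dvdnP[l e] : (M %| s - i)%N by rewrite -eqn_mod_dvd.
    rewrite hornerZ horner_shift e mulnK //.
    have sE : s = (l * M + i)%N :> nat by rewrite -e subnK.
    have lj : (l <= j)%N.
      move: sn; rewrite sE /n leq_add2r mulnC leq_mul2l; move: M0; case: eqP => //; lia.
    have -> : ((n - s) %/ M = j - l)%N.
      by rewrite sE /n subnDr [(M * j)%N]mulnC -mulnBl mulnK.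
    have -> : j%:R + (d%:R - l%:R) = (j - l + d)%:R :> K.
      by rewrite natrD natrB //; ring.
    have -> : q ^+ j = q ^+ (j - l) * q ^+ l by rewrite -exprD subnK.
    rewrite binom_poly_nat; field.
    by rewrite ?expf_neq0 ?oppr_eq0 ?oner_eq0 ?q0 ?oner_eq0.
  by rewrite mulr0.
case: ifP => //= si.
have is_ : (i <= s)%N by rewrite /n in sn; lia.
have /dvdnP[l e] : (M %| s - i)%N by rewrite -eqn_mod_dvd // eq_sym.
rewrite hornerZ horner_shift e mulnK //.
have sE : s = (l * M + i)%N :> nat by rewrite -e subnK.
have lj : (j < l)%N.
  move: sn; rewrite sE /n leq_add2r [(M * j)%N]mulnC leq_mul2r; lia.
have ld : (l <= d)%N.
  have := leq_trans (ltn_ord s) sR; rewrite sE mulnC => H.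
  by rewrite -ltnS -(ltn_pmul2l M0); lia.
have -> : j%:R + (d%:R - l%:R) = (j + d - l)%:R :> K.
  by rewrite natrB ?natrD; [ring|rewrite (leq_trans ld) ?leq_addl].
by rewrite binom_poly_nat bin_small ?mulr0 //; lia.
Qed.

(** For i = M the numerator has degree less than d in 'X^M, after removal of
    'X^M itself; this shows as a zero at j = -1. *)
Lemma residue_poly_last M q d R : (0 < M)%N -> (size R <= M * d.+1)%N ->
  (residue_poly M q d R M).[-1] = 0.
Proof.
move=> M0 sR; rewrite /residue_poly horner_sum big1 // => s /andP[s0 sM].
have Ms : (M <= s)%N.
  rewrite leqNgt; apply/negP => sM'; move: sM; rewrite eq_sym eqn_mod_dvd 1?ltnW //.
  by rewrite gtnNdvd //; lia.
have /dvdnP[l e] : (M %| s - M)%N by rewrite -eqn_mod_dvd // eq_sym.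
have sE : s = (l * M + M)%N :> nat by rewrite -e subnK.
have ld : (l.+1 <= d)%N.
  have := leq_trans (ltn_ord s) sR; rewrite sE mulnC => H.
  by rewrite -(ltn_pmul2l M0); lia.
rewrite hornerZ horner_shift e mulnK //.
have -> : -1 + (d%:R - l%:R) = (d - l.+1)%:R :> K.
  by rewrite natrB // -natr1; ring.
by rewrite binom_poly_nat bin_small ?mulr0 //; lia.
Qed.

End QuasiPolynomials.

(** * The Taylor coefficients of 2(3-2t)/(t^2-2t+2) *)

Fixpoint pi_coef n : rat :=
  match n with
  | 0 => 3
  | 1 => 1
  | (m.+1 as m').+1 => pi_coef m' - pi_coef m / 2
  end.

Arguments pi_coef : simpl never.

Lemma pi_coefSS n : pi_coef n.+2 = pi_coef n.+1 - pi_coef n / 2.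
Proof. by []. Qed.

Lemma pi_coef4 n : pi_coef (4 + n) = (- 4)^-1 * pi_coef n.
Proof. by rewrite !addSn add0n !pi_coefSS; field. Qed.

Lemma pi_coef_period k n : pi_coef (4 * k + n) = (- 4) ^- k * pi_coef n.
Proof.
elim: k => [|k IHk]; first by rewrite muln0 expr0 invr1 mul1r.
by rewrite mulnS -addnA pi_coef4 IHk exprS; field; rewrite expf_neq0.
Qed.

(** Extended to negative indices, the sequence F of the [pi_coef] satisfies
    F_(n-2) = 2 F_(n-1) - 2 F_n, so the backward shift T satisfies
    T^2 = 2T - 2.  The pair (x, y) stands for two consecutive values of a
    sequence read backwards, and [shift_back] is the action of T on it. *)
Definition shift_back (p : int * int) : int * int := (p.2, 2 * p.2 - 2 * p.1).
(** The operator 1 - 4T, which equals -3 +- 4i on the two exponential solutions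
    of the recurrence. *)
Definition newton_diff (p : int * int) : int * int := (p.1 - 4 * p.2, 8 * p.1 - 7 * p.2).
(** The value of T^s (1 - 4T)^m on the sequence, normalised so that the initial
    pair (4, 2) is F_(-1), F_(-2); the numbers [diff_coef 0 m] are the c_m that
    decide about the degree of S. *)
Definition diff_coef s m : int := (iter s shift_back (iter m newton_diff (4, 2))).1.

Lemma diff_coefS s m : diff_coef s m.+1 = diff_coef s m - 4 * diff_coef s.+1 m.
Proof.
rewrite /diff_coef [iter s.+1 _ _]iterS /=; set p := iter m newton_diff _.
suff -> : iter s shift_back (newton_diff p) = newton_diff (iter s shift_back p) by [].
by elim: s => //= s ->; rewrite /shift_back /newton_diff /=; congr (_, _); ring.
Qed.

Lemma diff_coefSS s m : diff_coef s.+2 m = 2 * diff_coef s.+1 m - 2 * diff_coef s m.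
Proof. by []. Qed.

(** Modulo 3 the pair (x, y) only visits states with x <> 0 and
    y = 0 or y = -x. *)
Lemma diff_coef_ndvd3 m : ~~ (3 %| diff_coef 0 m)%Z.
Proof.
suff: ~~ (3 %| diff_coef 0 m)%Z && ((3 %| (iter m newton_diff (4, 2)).2)%Z ||
  (3 %| (diff_coef 0 m + (iter m newton_diff (4, 2)).2)%R)%Z) by case/andP.
rewrite /diff_coef /=; elim: m => [//|m] /=.
by case: (iter m newton_diff _) => a b /=; lia.
Qed.

Lemma pi_coef_backward k s : (s < 4 * k)%N ->
  pi_coef (4 * k - 1 - s) = (- 4) ^- k * (diff_coef s 0)%:~R.
Proof.
case: k => [|k]; first by rewrite muln0.
elim/ltn_ind: s => -[|[|s]] IHs sk.
- have -> : (4 * k.+1 - 1 - 0 = 4 * k + 3)%N by lia.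
  rewrite pi_coef_period exprS (_ : pi_coef 3 = -1) // (_ : diff_coef 0 0 = 4) //.
  by field; rewrite expf_neq0.
- have -> : (4 * k.+1 - 1 - 1 = 4 * k + 2)%N by lia.
  rewrite pi_coef_period exprS (_ : pi_coef 2 = - 2^-1) // (_ : diff_coef 1 0 = 2) //.
  by field; rewrite expf_neq0.
rewrite diff_coefSS rmorphB !rmorphM /=.
have [sk1 sk0] : (s.+1 < 4 * k.+1)%N /\ (s < 4 * k.+1)%N by lia.
have := IHs s.+1 (ltnSn _) sk1; have := IHs s (leqW (ltnSn _)) sk0.
have -> : (4 * k.+1 - 1 - s = (4 * k.+1 - 1 - s.+2).+2)%N by lia.
have -> : (4 * k.+1 - 1 - s.+1 = (4 * k.+1 - 1 - s.+2).+1)%N by lia.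
rewrite pi_coefSS => E0 E1; rewrite !mulrBr.
have -> : forall x y z t : rat, x * (y * z) - x * (y * t) =
  y * (x * z) - y * (x * t) by move=> *; ring.
by rewrite -E0 -E1; field.
Qed.

(** * A sum that is not zero for 3-adic reasons *)

(** Let 3^a be the largest power of 3 below 2M.  The only odd multiple of 3^a
    below 2M is 3^a itself, so after multiplication by 3^a all terms but one are
    3-adically divisible by 3. *)
Lemma sum_odd_inv_neq0 (c : nat -> int) M : (0 < M)%N ->
    (forall m, ~~ (3 %| c m)%Z) ->
  \sum_(m < M) (c m)%:~R / (2 * m + 1)%:R != 0 :> rat.
Proof.
move=> M0 c3; pose a := trunc_log 3 (2 * M - 1).
have [am aM] : (3 ^ a <= 2 * M - 1 /\ 2 * M - 1 < 3 ^ a.+1)%N.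
  by split; [apply: trunc_logP; lia|apply: trunc_log_ltn].
pose m0 := (3 ^ a)./2.
have a2 : (2 * m0 + 1 = 3 ^ a)%N.
  by rewrite /m0 -[RHS]odd_double_half oddX orbT -mul2n addnC.
have m0M : (m0 < M)%N by lia.
(* the multiples of 3 in the ring of 3-adically integral rationals *)
pose multiple3 (x : rat) :=
  exists2 d : nat, ~~ (3 %| d)%N & exists z : int, x * d%:R = 3 * z%:~R.
have m3D x y : multiple3 x -> multiple3 y -> multiple3 (x + y).
  move=> [d d3 [z xz]] [e e3 [t yt]]; exists (d * e)%N.
    by rewrite Euclid_dvdM // negb_or d3.
  exists (z * e%:Z + t * d%:Z); rewrite natrM rmorphD !rmorphM /= mulrDl.
  by rewrite mulrA xz [d%:R * _]mulrC mulrA yt !pmulrn; ring.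
apply/eqP => sum0.
have: multiple3 (- (c m0)%:~R).
  have -> : - (c m0)%:~R = \sum_(m < M | m != Ordinal m0M)
      ((c m)%:~R / (2 * m + 1)%:R) * (3 ^ a)%:R :> rat.
    move: sum0; rewrite (bigD1 (Ordinal m0M)) //= a2 => /(congr1 ( *%R^~ (3 ^ a)%:R)).
    rewrite mul0r mulrDl mulfVK ?pnatr_eq0 ?expn_eq0 // mulr_suml => /eqP.
    by rewrite addr_eq0 => /eqP ->; rewrite opprK.
  apply: (big_ind multiple3) => //; first by exists 1%N => //; exists 0; ring.
  move=> m mm0; have mM := ltn_ord m; pose e := logn 3 (2 * m + 1).
  have [d d3 md] : exists2 d, ~~ (3 %| d)%N & (2 * m + 1 = d * 3 ^ e)%N.
    have p3 : (0 < 2 * m + 1)%N by rewrite addn1.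
    have [d cd ->] := pfactor_coprime (isT : prime 3) p3.
    by exists d => //; rewrite -prime_coprime.
  have d0 : (0 < d)%N by case: d d3 {md} => [|d]; rewrite ?dvdn0.
  have ea : (e < a)%N.
    rewrite ltnNge; apply/negP => ae.
    have e3 : (3 ^ e < 3 ^ a.+1)%N.
      by apply: leq_ltn_trans aM; rewrite (leq_trans (leq_pmull _ d0)) // -md; lia.
    have ea : e = a.
      apply/eqP; rewrite eqn_leq ae.
      by rewrite -ltnS -(ltn_exp2l _ _ (isT : (1 < 3)%N)) e3.
    move: mm0; rewrite -val_eqE /= => /eqP; apply.
    rewrite ea in md; move: aM; rewrite expnS => aM.
    have dlt : (d * 3 ^ a < 3 * 3 ^ a)%N by rewrite -md; apply: leq_ltn_trans aM; lia.
    have d12 : (d < 3)%N by rewrite ltn_mul2r expn_gt0 in dlt.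
    move: md a2; case: d d12 d0 {d3 dlt} => [|[|[|//]]] // _ _.
      by rewrite mul1n => <- /eqP; rewrite eqn_add2r eqn_mul2l => /eqP.
    by move/(congr1 odd); rewrite !oddM oddD oddM.
  exists d => //; exists ((3 ^ (a - e.+1))%:Z * c m).
  rewrite md -(subnK ea) expnD expnS !natrM rmorphM /= pmulrn addnK; field.
  by rewrite !pnatr_eq0 expn_eq0 -lt0n d0.
move=> [d d3 [z]]; rewrite mulNr => /eqP.
have -> : - ((c m0)%:~R * d%:R) = (- (c m0 * d%:Z))%:~R :> rat.
  by rewrite rmorphN rmorphM.
rewrite -[3]/(3%:~R) -rmorphM /= eqr_int => /eqP cz.
have : (3 %| c m0 * d%:Z)%Z.
  by move/(congr1 absz): cz; rewrite dvdzE abszN => ->; rewrite abszM dvdn_mulr.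
move: d3 (c3 m0); rewrite !dvdzE abszM Euclid_dvdM // absz_nat => d3 c3' /orP[].
  by rewrite (negPf c3').
by rewrite (negPf d3).
Qed.

(** * Central binomial coefficients and Newton interpolation *)

(** The integral of (x(1-x))^n over [0,1]. *)
Definition beta_int (K : numFieldType) n : K := ((2 * n%:R + 1) * 'C(n.*2, n)%:R)^-1.

Section CentralBinomials.
Variable K : numFieldType.
Implicit Type p : {poly K}.

Lemma odd_neq0 n : 2 * n%:R + 1 != 0 :> K.
Proof. by rewrite -natrM natr1 pnatr_eq0. Qed.

Lemma central_bin_neq0 n : 'C(n.*2, n)%:R != 0 :> K.
Proof. by rewrite pnatr_eq0 -lt0n bin_gt0 -addnn leq_addr. Qed.

Lemma beta_int0 : beta_int K 0 = 1.
Proof. by rewrite /beta_int bin0; field. Qed.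

Lemma beta_intS n :
  beta_int K n.+1 = (n%:R + 1) / (4 * n%:R + 6) * beta_int K n.
Proof.
rewrite /beta_int central_binS -natr1; field.
have h := odd_neq0 n; have h1 := odd_neq0 n.+1.
rewrite -[n.+1%:R]natr1 in h1; have n1 : n%:R + 1 != 0 :> K by rewrite natr1 pnatr_eq0.
rewrite h central_bin_neq0 n1 [1 + _]addrC h1 /= andbT.
have -> : 4 * n%:R + 6 = 2 * (2 * (n%:R + 1) + 1) :> K by ring.
by rewrite mulf_neq0 ?pnatr_eq0.
Qed.

(** The integral of (1-x^2)^n over [0,1]. *)
Definition wallis n : K := 4 ^+ n * beta_int K n.

Lemma wallisS n : (n%:R + 3 / 2) * wallis n.+1 = (n%:R + 1) * wallis n.
Proof.
rewrite /wallis beta_intS exprS; field.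
have h1 := odd_neq0 n.+1; rewrite -[n.+1%:R]natr1 in h1.
have -> : 4 * n%:R + 6 = 2 * (2 * (n%:R + 1) + 1) :> K by ring.
by rewrite mulf_neq0 ?pnatr_eq0.
Qed.

(** Between the values G' of g_(i+1) and G of g_i the recurrence reads
    (r + 3/2) G'(r+1) = 4 (r+1) G(r) + F_i.  If their Newton coefficients are
    (-1)^m wallis_m times A_m and B_m, it amounts to A_m - A_(m+1) = 4 B_m and
    A_0 = 2 F_i; [wallisS] is the reason for the factor wallis_m. *)
Lemma newton_wallisS (A : nat -> K) r :
  (r.+1%:R + 2^-1) *
    (\sum_(m < r.+2) (-1) ^+ m * 'C(r.+1, m)%:R * wallis m * A m) =
  r.+1%:R * (\sum_(m < r.+1) (-1) ^+ m * 'C(r, m)%:R * wallis m * (A m - A m.+1))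
  + A 0%N / 2.
Proof.
have -> : \sum_(m < r.+1) (-1) ^+ m * 'C(r, m)%:R * wallis m * (A m - A m.+1) =
    \sum_(m < r.+2) (-1) ^+ m * 'C(r, m)%:R * wallis m * A m -
    \sum_(m < r.+1) (-1) ^+ m * 'C(r, m)%:R * wallis m * A m.+1.
  rewrite [X in X - _]big_ord_recr /= bin_small // !(mulr0, mul0r) addr0 -sumrB.
  by apply: eq_bigr => m _; ring.
rewrite !(big_ord_recl r.+1) !bin0 mulrDr mulrBr mulrDr !mulr_sumr.
have -> : \sum_(i < r.+1) (r.+1%:R + 2^-1) * ((-1) ^+ lift ord0 i *
      'C(r.+1, lift ord0 i)%:R * wallis (lift ord0 i) * A (lift ord0 i)) =
    \sum_(i < r.+1) r.+1%:R * ((-1) ^+ lift ord0 i *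
      'C(r, lift ord0 i)%:R * wallis (lift ord0 i) * A (lift ord0 i)) -
    \sum_(i < r.+1) r.+1%:R * ((-1) ^+ i * 'C(r, i)%:R * wallis i * A i.+1).
  rewrite -sumrB; apply: eq_bigr => m _; rewrite !lift0.
  have mr := ltn_ord m.
  have E1 : r.+1%:R * 'C(r, m)%:R = m.+1%:R * 'C(r.+1, m.+1)%:R :> K.
    by rewrite -!natrM mul_bin_diag.
  have E2 : r.+1%:R * 'C(r, m.+1)%:R = (r.+1%:R - m.+1%:R) * 'C(r.+1, m.+1)%:R :> K.
    by rewrite -natrB // -!natrM mul_bin_down.
  have -> : r.+1%:R * ((-1) ^+ m.+1 * 'C(r, m.+1)%:R * wallis m.+1 * A m.+1) =
    (r.+1%:R * 'C(r, m.+1)%:R) * ((-1) ^+ m.+1 * wallis m.+1 * A m.+1) by ring.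
  have -> : r.+1%:R * ((-1) ^+ m * 'C(r, m)%:R * wallis m * A m.+1) =
    (r.+1%:R * 'C(r, m)%:R) * ((-1) ^+ m * wallis m * A m.+1) by ring.
  rewrite E1 E2 exprS; have W := wallisS m.
  have -> : m.+1%:R * 'C(r.+1, m.+1)%:R * ((-1) ^+ m * wallis m * A m.+1) =
    ((m%:R + 1) * wallis m) * ('C(r.+1, m.+1)%:R * (-1) ^+ m * A m.+1).
    by rewrite -natr1; ring.
  by rewrite -W -!natr1; field.
by rewrite /= /wallis beta_int0; field.
Qed.

Lemma poly_roots_eq0 p n (x : nat -> K) : (size p <= n)%N ->
    {in gtn n &, injective x} -> (forall i, (i < n)%N -> p.[x i] = 0) ->
  p = 0.
Proof.
move=> sp xI px; apply/eqP; apply: contraTT sp => p0; rewrite -ltnNge.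
have := @max_poly_roots _ p [seq x i | i <- iota 0 n] p0.
rewrite size_map size_iota; apply.
  by apply/allP => _ /mapP[i + ->]; rewrite mem_iota => /= i_n; apply/rootP/px.
rewrite map_inj_in_uniq ?iota_uniq // => i j; rewrite !mem_iota => *.
exact: xI.
Qed.

Lemma poly_nat_eq0 p : (forall n : nat, p.[n%:R] = 0) -> p = 0.
Proof.
move=> p0; apply: (@poly_roots_eq0 p (size p) (fun n => n%:R)) => // i j _ _.
by move/eqP; rewrite eqr_nat => /eqP.
Qed.

Lemma coef_linear_mul p (a b : K) d : (size p <= d.+1)%N ->
  ((a *: 'X + b%:P) * p)`_d.+1 = a * p`_d.
Proof.
move=> sp; rewrite mulrDl -scalerAl coefD coefZ coefXM /= coefCM.
by rewrite [p`_d.+1]nth_default // mulr0 addr0.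
Qed.

End CentralBinomials.

(** * The recurrence between the polynomials g_i *)

Section Recurrence.
(** The factor e is 1 for the system and 0 for its homogeneous version. *)
Variables (k : nat) (g : nat -> {poly rat}) (S : {poly rat}) (e : rat).
Hypothesis k0 : (0 < k)%N.
Let M := (4 * k)%N.
Let q : rat := (- 4) ^+ k.
Hypothesis size_g : forall i, (0 < i <= M)%N -> (size (g i) <= M.+1)%N.
Hypothesis g_end : (g M).[-1] = 0.
Hypothesis g_step : forall i x, (0 < i < M)%N ->
  (M%:R * x + i%:R + 1) * (g i.+1).[x] =
  2 * (2 * (M%:R * x + i%:R) + 1) * (g i).[x] + e * pi_coef i.
Hypothesis g_wrap : forall x,
  (M%:R * x + 1) * (g 1).[x] =
  2 * (2 * (M%:R * x) + 1) * q * (g M).[x - 1] + e * pi_coef 0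
  - (2 * (M%:R * x) + 1) * S.[x].

(** The argument of g_i that corresponds to the index n = r + 1/2. *)
Let node i r : rat := (r%:R + 2^-1 - i%:R) / M%:R.

Let M0 : M%:R != 0 :> rat.
Proof. by rewrite pnatr_eq0 /M; lia. Qed.

Let q0 : q != 0.
Proof. by rewrite expf_neq0. Qed.

Let node_step i r : node i.+1 r.+1 = node i r.
Proof. by rewrite /node -!natr1; congr (_ / _); ring. Qed.

Let node_index i r : M%:R * node i r = r%:R + 2^-1 - i%:R.
Proof. by rewrite mulrC mulfVK. Qed.

(** At r = 0 the coefficient of the preceding polynomial vanishes, which starts
    the induction on i for every i; the step is [newton_wallisS]. *)
Lemma g_node i r : (0 < i <= M)%N -> (r < i)%N ->
  (g i).[node i r] = 2 * e / q *
    \sum_(m < r.+1) (-1) ^+ m * 'C(r, m)%:R * wallis rat m * (diff_coef (M - i) m)%:~R.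
Proof.
move: i r; have base i : (i < M)%N ->
    2^-1 * (g i.+1).[node i.+1 0] = e * pi_coef i ->
    (g i.+1).[node i.+1 0] = 2 * e / q * \sum_(m < 1) (-1) ^+ m *
      'C(0, m)%:R * wallis rat m * (diff_coef (M - i.+1) m)%:~R.
  move=> iM gi; have -> : (g i.+1).[node i.+1 0] = 2 * (e * pi_coef i).
    by rewrite -gi; field.
  rewrite big_ord1 /= /wallis beta_int0 bin0.
  have -> : i = (4 * k - 1 - (M - i.+1))%N by rewrite /M in iM *; lia.
  rewrite pi_coef_backward; last by rewrite /M in iM *; lia.
  have -> : (M - (4 * k - 1 - (M - i.+1)).+1 = M - i.+1)%N.
    by rewrite /M in iM *; lia.
  by rewrite /q !expr0; ring.
elim=> // i IHi r iM; case: (posnP i) => [i0|i0].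
  rewrite i0 ltnS leqn0 => /eqP ->; apply: base; first by rewrite -i0.
  have := g_wrap (node 1 0); rewrite node_index.
  have -> : 2 * (0 + 2^-1 - 1) + 1 = 0 :> rat by field.
  by rewrite mulr0 !mul0r [0 + e * _]add0r subr0 => <-; congr (_ * _); field.
have := g_step (node i.+1 r) (_ : (0 < i < M)%N); rewrite node_index.
have ii : (0 < i < M)%N by rewrite i0; case/andP: iM.
case: r => [|r] /(_ ii) H ri.
  apply: base; first by case/andP: ii.
  move: H; have -> : 2 * (0%:R + 2^-1 - i.+1%:R + i%:R) + 1 = 0 :> rat.
    by rewrite -natr1; field.
  by rewrite mulr0 mul0r [0 + e * _]add0r => <-; congr (_ * _); rewrite -natr1; field.
have r32 : r.+1%:R + 2^-1 != 0 :> rat.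
  by rewrite lt0r_neq0 // ltr_pwDr ?invr_gt0 ?ler0n.
apply: (mulfI r32).
have -> : (r.+1%:R + 2^-1) * (2 * e / q *
     \sum_(m < r.+2) (-1) ^+ m * 'C(r.+1, m)%:R * wallis rat m * (diff_coef (M - i.+1) m)%:~R) =
     2 * e / q * ((r.+1%:R + 2^-1) * (\sum_(m < r.+2) (-1) ^+ m *
      'C(r.+1, m)%:R * wallis rat m * (diff_coef (M - i.+1) m)%:~R)) by ring.
rewrite (newton_wallisS (fun m => (diff_coef (M - i.+1) m)%:~R)).
have -> : \sum_(m < r.+1) (-1) ^+ m * 'C(r, m)%:R * wallis rat m *
     ((diff_coef (M - i.+1) m)%:~R - (diff_coef (M - i.+1) m.+1)%:~R) =
   4 * \sum_(m < r.+1) (-1) ^+ m * 'C(r, m)%:R * wallis rat m *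
     (diff_coef (M - i) m)%:~R.
  rewrite mulr_sumr; apply: eq_bigr => m _; rewrite diff_coefS.
  have -> : (M - i.+1).+1 = (M - i)%N by case/andP: ii; lia.
  by rewrite rmorphB rmorphM /=; ring.
have := IHi r; rewrite i0 (ltnW (proj2 (andP ii))) => /(_ isT ri).
rewrite -node_step => E.
have -> : forall x y z : rat, 2 * e / q * (x * (4 * y) + z / 2) =
  4 * x * (2 * e / q * y) + e * (q^-1 * z) by move=> *; field.
rewrite -E; have := @pi_coef_backward k (M - i.+1).
have -> : (4 * k - 1 - (M - i.+1) = i)%N by case/andP: ii; rewrite /M; lia.
move=> <-; last by case/andP: ii; rewrite /M; lia.
transitivity ((r.+1%:R + 2^-1 - i.+1%:R + i%:R + 1) * (g i.+1).[node i.+1 r.+1]).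
  by rewrite -natr1; congr (_ * _); ring.
by rewrite H -!natr1; congr (_ * _ + _); field.
Qed.

Let node_inj i : injective (node i).
Proof.
move=> r s /(mulIf (invr_neq0 M0)) /addIr /addIr /eqP.
by rewrite eqr_nat => /eqP.
Qed.

Let node_neqN1 r : (node M r == -1) = false.
Proof.
apply/negP => /eqP /(congr1 ( *%R M%:R)); rewrite node_index => h.
have : r%:R + 2^-1 = (r%:R + 2^-1 - M%:R) + M%:R :> rat by ring.
rewrite h mulrN1 addNr; apply/eqP.
by rewrite lt0r_neq0 // ltr_wpDl ?ler0n ?invr_gt0.
Qed.

(** By [g_node], g_M vanishes at M nodes, and also at -1; its degree is at most
    M.  From g_M = 0 one descends to all g_i and to S. *)
Lemma homogeneous_eq0 : e = 0 ->
  (forall i, (0 < i <= M)%N -> g i = 0) /\ S = 0.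
Proof.
move=> e0; have Mpos : (0 < M)%N by rewrite /M; lia.
have gM : g M = 0.
  apply: (@poly_roots_eq0 _ _ M.+1 (fun r => if (r < M)%N then node M r else -1)).
  - by rewrite size_g // Mpos leqnn.
  - move=> r s; rewrite !inE !ltnS => rM sM.
    case: ltnP => rM'; case: ltnP => sM'; first exact: node_inj.
    + by move/eqP; rewrite node_neqN1.
    + by move/esym/eqP; rewrite node_neqN1.
    + by move=> _; apply/eqP; rewrite eqn_leq (leq_trans rM sM') (leq_trans sM rM').
  move=> r _ /=; case: ltnP => [rM|_]; last exact: g_end.
  rewrite g_node ?Mpos ?leqnn //.
  by rewrite e0 mulr0 !mul0r.
have odd_pos (n : nat) : 2 * n%:R + 1 != 0 :> rat by apply: odd_neq0.
have g0 j : (j < M)%N -> g (M - j) = 0.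
  elim: j => [|j IHj] jM; first by rewrite subn0.
  have jM' : (0 < M - j.+1 < M)%N by lia.
  apply: poly_nat_eq0 => n; have := g_step n%:R jM'.
  rewrite e0 (_ : (M - j.+1).+1 = M - j)%N; last by lia.
  rewrite (IHj (ltnW jM)) horner0 mul0r addr0 mulr0 => /esym/eqP.
  by rewrite !mulf_eq0 pnatr_eq0 /= -natrM -natrD (negPf (odd_pos _)) => /eqP.
have {}g0 i : (0 < i <= M)%N -> g i = 0.
  by move=> /andP[i0 iM]; rewrite -(subKn iM) g0 //; lia.
split=> //; apply: poly_nat_eq0 => n; have := g_wrap n%:R.
rewrite e0 !g0 ?horner0 ?Mpos ?leqnn // !(mulr0, mul0r) !add0r => /esym/eqP.
by rewrite oppr_eq0 mulf_eq0 -natrM (negPf (odd_pos _)) => /eqP.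
Qed.

(** If deg S < M, then passing from g_i to g_(i+1) multiplies the coefficient of
    degree M by 4, and passing from g_M to g_1 multiplies it by 4q; the whole
    cycle multiplies it by 4^M q, which is not 1. *)
Lemma top_coef_last : (size S <= M)%N -> (g M)`_M = 0.
Proof.
move=> sS; have Mpos : (0 < M)%N by rewrite /M; lia.
have step i : (0 < i < M)%N -> (g i.+1)`_M = 4 * (g i)`_M.
  move=> iM; have [s1 s2] : (size (g i) <= M.+1)%N /\ (size (g i.+1) <= M.+1)%N.
    by split; apply: size_g; lia.
  have E : (M%:R *: 'X + (i%:R + 1)%:P) * g i.+1 =
      ((4 * M%:R) *: 'X + (4 * i%:R + 2)%:P) * g i + (e * pi_coef i)%:P.
    apply/eqP; rewrite -subr_eq0; apply/eqP/poly_nat_eq0 => n.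
    rewrite !(hornerD, hornerN, hornerM, hornerZ, hornerX, hornerC).
    have /eqP := g_step n%:R iM; rewrite -subr_eq0 => /eqP <-.
    by ring.
  move/(congr1 (fun p : {poly rat} => p`_M.+1)): E.
  rewrite coefD !coef_linear_mul // coefC /= addr0 [4 * M%:R]mulrC -mulrA.
  exact: mulfI.
have wrap : (g 1)`_M = 4 * q * (g M)`_M.
  have E : (M%:R *: 'X + 1%:P) * g 1 = ((4 * M%:R * q) *: 'X + (2 * q)%:P) *
     (g M \Po ('X + (-1)%:P)) + (e * pi_coef 0)%:P - ((2 * M%:R) *: 'X + 1%:P) * S.
    apply/eqP; rewrite -subr_eq0; apply/eqP/poly_nat_eq0 => n.
    rewrite !(hornerD, hornerN, hornerM, horner_shift, hornerZ, hornerX, hornerC).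
    have /eqP := g_wrap n%:R; rewrite -subr_eq0 => /eqP <-.
    by ring.
  move/(congr1 (fun p : {poly rat} => p`_M.+1)): E.
  rewrite coefB coefD !coef_linear_mul ?size_comp_shift ?size_g ?Mpos ?leqnn //;
    last by rewrite leqW.
  rewrite coef_comp_shift ?size_g ?Mpos ?leqnn // coefC /= addr0.
  rewrite [S`_M]nth_default // mulr0 subr0 => H; apply: (mulfI M0).
  by rewrite H; ring.
have pow i : (i < M)%N -> (g i.+1)`_M = 4 ^+ i * (g 1)`_M.
  elim: i => [|i IHi] iM; first by rewrite mul1r.
  by rewrite step ?IHi ?exprS ?mulrA //; lia.
have := pow M.-1; rewrite prednK // wrap => /(_ (leqnn _)) => E.
have : (1 - 4 ^+ M * q) * (g M)`_M = 0.
  have -> : 4 ^+ M = 4 * 4 ^+ M.-1 :> rat by rewrite -exprS prednK.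
  apply/eqP; rewrite mulrBl mul1r subr_eq0; apply/eqP; rewrite {1}E; ring.
move/eqP; rewrite mulf_eq0 => /orP[|/eqP //].
rewrite subr_eq0 => /eqP /(congr1 (fun x : rat => `|x|)).
rewrite normr1 /q normrM !normrX normrN ger0_norm // -exprD => /esym/eqP.
by rewrite gt_eqF // exprn_egt1 // -lt0n addn_gt0 Mpos.
Qed.

Lemma size_S_gt : e = 1 -> (M < size S)%N.
Proof.
move=> e1; rewrite ltnNge; apply/negP => sS.
have Mpos : (0 < M)%N by rewrite /M; lia.
have sg : (size (g M) <= M)%N.
  by apply: size_leS (top_coef_last sS); rewrite size_g ?Mpos ?leqnn.
(* the Newton interpolation polynomial of the values in g_node *)
pose Z : {poly rat} := (2 / q) *: \sum_(m < M)
  ((-1) ^+ m * wallis rat m * (diff_coef 0 m)%:~R) *: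
  (binom_poly rat m \Po (M%:R *: 'X + (M%:R - 2^-1)%:P)).
have ZE x : Z.[x] = 2 / q * \sum_(m < M)
  (-1) ^+ m * wallis rat m * (diff_coef 0 m)%:~R * (binom_poly rat m).[M%:R * x + (M%:R - 2^-1)].
  rewrite /Z hornerZ horner_sum; congr (_ * _); apply: eq_bigr => m _.
  by rewrite hornerZ horner_comp hornerD (hornerZ M%:R) hornerX hornerC.
have sZ : (size Z <= M)%N.
  rewrite (leq_trans (size_scale_leq _ _)) //; apply: (leq_trans (size_sum _ _ _)).
  apply/bigmax_leqP => m _; rewrite (leq_trans (size_scale_leq _ _)) //.
  rewrite size_comp_poly2; first by rewrite (leq_trans (size_binom_poly _ _)).
  by rewrite size_polyDl size_scale // size_polyX // size_polyC; case: eqP.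
have gZ : g M = Z.
  apply/eqP; rewrite -subr_eq0; apply/eqP.
  apply: (@poly_roots_eq0 _ _ M (node M)).
  - by rewrite (leq_trans (size_polyD _ _)) // size_polyN geq_max sg.
  - by move=> r s _ _; apply: node_inj.
  move=> r rM; rewrite hornerD hornerN g_node ?Mpos ?leqnn // ZE e1 mulr1.
  rewrite node_index subnn (_ : _ + (M%:R - 2^-1) = r%:R); last by ring.
  apply/eqP; rewrite subr_eq0; apply/eqP; congr (_ * _).
  rewrite (big_ord_widen M (fun m => (-1) ^+ m * 'C(r, m)%:R * wallis rat m *
    (diff_coef 0 m)%:~R)) // big_mkcond; apply: eq_bigr => m _.
  rewrite binom_poly_nat ltnS; case: leqP => mr; first by ring.
  by rewrite bin_small // mulr0.
have := g_end; rewrite gZ ZE => /eqP; rewrite mulf_eq0 mulf_eq0 invr_eq0 (negPf q0) /=.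
rewrite (_ : \sum_(m < M) _ = \sum_(m < M) (diff_coef 0 m)%:~R / (2 * m + 1)%:R).
  by rewrite (negPf (sum_odd_inv_neq0 _ diff_coef_ndvd3)).
apply: eq_bigr => m _; rewrite (_ : _ + (_ - 2^-1) = - 2^-1); last by ring.
rewrite binom_poly_half /wallis /beta_int mulrCA.
have h : (-1) ^+ m * (-1) ^+ m = 1 :> rat.
  by rewrite -exprD addnn -signr_odd odd_double.
transitivity ((-1) ^+ m * (-1) ^+ m * (diff_coef 0 m)%:~R / (2 * m%:R + 1) : rat).
  by field; rewrite odd_neq0 central_bin_neq0 expf_neq0.
by rewrite h mul1r natrD natrM.
Qed.

End Recurrence.

(** * The linear system *)

Lemma coef_sum_monomials (f : nat -> rat) m n i :
  (\sum_(m <= j < n) f j *: 'X^j)`_i = if (m <= i < n)%N then f i else 0.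
Proof.
rewrite coef_sum; case: ifP => imn.
  rewrite (bigD1_seq i) ?mem_index_iota ?iota_uniq //= coefZ coefXn eqxx mulr1.
  by rewrite big1 ?addr0 // => j ji; rewrite coefZ coefXn eq_sym (negPf ji) mulr0.
rewrite big_nat_cond big1 // => j; rewrite andbT coefZ coefXn => jmn.
by case: eqP => [ij|_]; [rewrite ij jmn in imn|rewrite mulr0].
Qed.

Lemma size_linear (c b : rat) : (size (c *: 'X + b%:P)%R <= 2)%N.
Proof.
rewrite (leq_trans (size_polyD _ _)) // geq_max size_polyC.
rewrite (leq_trans (size_scale_leq _ _)) ?size_polyX //=.
by case: (b == 0).
Qed.

Section System.
Variable k : nat.
Hypothesis k0 : (0 < k)%N.
Let M := (4 * k)%N.
Let q : rat := (- 4) ^+ k.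
Let Q : {poly rat} := Qpoly k.
Let Mpos : (0 < M)%N. Proof. by rewrite /M; lia. Qed.
Let q0 : q != 0. Proof. by rewrite expf_neq0. Qed.
Implicit Type a : unknowns k.

Lemma NkE : Nk k = (M * M.+1)%N.
Proof. by rewrite /Nk /M addn1. Qed.

Lemma coef_Rcheck a i :
  (Rcheck a)`_i = if (1 <= i < Nk k)%N then unknown a i else 0.
Proof. exact: coef_sum_monomials. Qed.

Lemma coef_Spoly a i :
  (Spoly a)`_i = if (i <= M)%N then unknown a (Nk k + i) else 0.
Proof. by rewrite coef_sum_monomials ltnS. Qed.

Lemma size_Rcheck a : (size (Rcheck a) <= M * M.+1)%N.
Proof.
by apply/leq_sizeP => j jN; rewrite coef_Rcheck NkE [(j < _)%N]ltnNge jN andbF.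
Qed.

Lemma size_Spoly a : (size (Spoly a) <= M.+1)%N.
Proof. by apply/leq_sizeP => j jM; rewrite coef_Spoly leqNgt jM. Qed.

Lemma size_Qpoly : size Q = M.+1.
Proof. by rewrite /Q /Qpoly size_XnsubC. Qed.

(** The coefficients of the generating series whose numerator is P. *)
Definition gen_seq a n : rat := if (M %| n)%N then gen_coef a (n %/ M) else 0.

Lemma coef_truncated_series a m :
  (Q ^+ (M + 2) * \sum_(0 <= n < m.+1) gen_coef a n *: 'X^(4 * k * n))`_m =
  conv (Q ^+ (M + 2)) (gen_seq a) m.
Proof.
rewrite coefM; apply: eq_bigr => i _; congr (_ * _).
rewrite coef_sum /gen_seq; have im := ltn_ord i; have := leq_subr i m.
move: (m - i)%N => s sm; under eq_bigr => j _ do rewrite coefZ coefXn -/M mulnC.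
case: ifP => [/dvdnP[j e]|sM].
  rewrite (bigD1_seq j) ?mem_index_iota ?iota_uniq //=; last first.
    rewrite ltnS (leq_trans _ sm) // e leq_pmulr //.
  rewrite e mulnK // eqxx mulr1 big1 ?addr0 // => l lj.
  by rewrite eqn_pmul2r // eq_sym (negPf lj) mulr0.
rewrite big1 // => j _; case: eqP => [e|_]; last by rewrite mulr0.
by rewrite e dvdn_mull in sM.
Qed.

Definition numer a : {poly rat} :=
  \poly_(m < Nk k + M) conv (Q ^+ (M + 2)) (gen_seq a) m.

Lemma gen_seqE a n : gen_seq a n = if (M %| n)%N then
  q ^- (n %/ M) * (((2 * M%:R) *: 'X + 1%:P) * Spoly a).[(n %/ M)%:R] else 0.
Proof.
rewrite /gen_seq; case: ifP => // _; rewrite /gen_coef.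
rewrite hornerM hornerD hornerZ hornerX hornerC mulrC.
have -> : (8 * k * (n %/ M) + 1)%:R = 2 * M%:R * (n %/ M)%:R + 1 :> rat.
  rewrite /M natrD !natrM; ring.
by rewrite mulrA.
Qed.

Lemma coef_numer a m : (numer a)`_m = conv (Q ^+ (M + 2)) (gen_seq a) m.
Proof.
rewrite coef_poly; case: ltnP => // Nm; symmetry.
apply: (conv_pow_eq0 Mpos q0 (h := ((2 * M%:R) *: 'X + 1%:P) * Spoly a) (j0 := 0)).
- apply: (leq_trans (size_polyMleq _ _)).
  rewrite -subn1 leq_subLR (_ : 1 + (M + 2) = 2 + M.+1)%N; last by lia.
  by rewrite leq_add ?size_linear ?size_Spoly.
- by move=> n _; exact: gen_seqE.
by rewrite add0n; move: Nm; rewrite NkE; lia.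
Qed.

Lemma is_numeratorP a P : is_numerator a P <-> P = numer a.
Proof.
split=> [aP|-> m]; last by rewrite coef_truncated_series coef_numer.
by apply/polyP => m; rewrite -aP coef_truncated_series coef_numer.
Qed.

(** The part of the left-hand side of the system that is linear in the
    unknowns, P being expressed through them. *)
Definition homog_lhs a : {poly rat} :=
  - (1 - 4 *: 'X) * Q * (Rcheck a)^`()
  + (2 *: Q + (M * M.+1)%:R *: ((1 - 4 *: 'X) * 'X^(M - 1))) * Rcheck a
  - numer a.

Definition quad : {poly rat} := 'X^2 - 2 *: 'X + 2%:P.

Definition inhomog : {poly rat} :=
  2 *: (3%:P - 2 *: 'X) * (Q ^+ (M + 2) %/ quad).

(** 'X^4 + 4 = ('X^2 - 2'X + 2)('X^2 + 2'X + 2) divides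
    ('X^4)^k - (-4)^k. *)
Lemma quad_dvd : quad %| Q.
Proof.
have D4 : 'X^4 + 4%:P = quad * ('X^2 + 2 *: 'X + 2%:P).
  rewrite /quad -!mul_polyC; ring.
have : 'X^4 + 4%:P %| Q.
  rewrite /Q /Qpoly exprM rmorphXn /= subrXX -{1}[4%:P]opprK -polyCN.
  exact: dvdp_mulr.
by apply: dvdp_trans; rewrite D4 dvdp_mulr.
Qed.

Lemma quad_inhomog : quad * inhomog = 2 *: (3%:P - 2 *: 'X) * Q ^+ (M + 2).
Proof.
rewrite /inhomog mulrCA [quad * _]mulrC divpK //.
by rewrite addn2 exprS dvdp_mulr // quad_dvd.
Qed.

Lemma size_quad : size quad = 3.
Proof.
have -> : quad = 'X^2 + ((- 2) *: 'X + 2%:P) by rewrite /quad scaleNr addrA.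
by rewrite size_polyDl size_polyXn // ltnS size_linear.
Qed.

Lemma Q_neq0 : Q != 0.
Proof. by rewrite -size_poly_eq0 size_Qpoly. Qed.

Lemma size_inhomog : (size inhomog <= Nk k + M)%N.
Proof.
apply: (leq_trans (size_polyMleq _ _)).
rewrite size_divp -?size_poly_eq0 size_quad //.
have E : size (Q ^+ (M + 2)) = (M * (M + 2)).+1.
  have := size_exp Q (M + 2); rewrite size_Qpoly /= => <-.
  by rewrite prednK // lt0n size_poly_eq0 expf_neq0 ?Q_neq0.
have L : (size (2 *: (3%:P - 2 *: 'X : {poly rat}))%R <= 2)%N.
  rewrite (leq_trans (size_scale_leq _ _)) // addrC -scaleNr; exact: size_linear.
rewrite E NkE; move: L; move: (size _) => s; lia.
Qed.

Lemma size_homog_lhs a : (size (homog_lhs a) <= Nk k + M)%N.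
Proof.
have sR := size_Rcheck a; have L := size_linear (-4) 1.
have e4 : 1 - 4 *: 'X = (- 4) *: 'X + 1%:P :> {poly rat}.
  by rewrite addrC scaleNr.
have sM (A B : {poly rat}) m n : (size A <= m.+1)%N -> (size B <= n)%N ->
    (size (A * B)%R <= m + n)%N.
  move=> sA sB; apply: (leq_trans (size_polyMleq _ _)).
  by move: (size A) (size B) sA sB => *; lia.
rewrite (leq_trans (size_polyD _ _)) // geq_max size_polyN size_poly andbT.
rewrite NkE (leq_trans (size_polyD _ _)) // geq_max addnC; apply/andP; split.
  have [->|R0] := eqVneq (Rcheck a) 0; first by rewrite deriv0 mulr0 size_poly0.
  have sR' := lt_size_deriv R0.
  rewrite mulNr mulNr size_polyN -mulrA e4.
  rewrite (@leq_trans (1 + (M + (M * M.+1 - 1)))%N) //; last by lia.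
  apply: (sM) => //; apply: (sM); first by rewrite size_Qpoly.
  by move: (size _) (size _) sR sR' => *; lia.
apply: (sM) => //; rewrite (leq_trans (size_polyD _ _)) // geq_max.
apply/andP; split; first by rewrite (leq_trans (size_scale_leq _ _)) ?size_Qpoly.
rewrite (leq_trans (size_scale_leq _ _)) // e4.
rewrite (@leq_trans (1 + M)%N) //; apply: (sM) => //.
by rewrite size_polyXn subn1 prednK.
Qed.

Lemma system_lhsE a P : is_numerator a P -> system_lhs a P = homog_lhs a + inhomog.
Proof.
by move=> /is_numeratorP ->; rewrite /system_lhs /homog_lhs /M addn1.
Qed.

(** By the degree bounds the equations of the system are all the coefficients
    of one polynomial identity. *)
Lemma solves_LP a : solves_L a <-> homog_lhs a + inhomog = 0.
Proof.
split=> [[P aP]|E].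
  rewrite (system_lhsE aP) => E; apply/polyP => m; rewrite coef0.
  have [mN|Nm] := ltnP m (Nk k + M); first exact: (E (Ordinal mN)).
  apply: nth_default; apply: leq_trans Nm; rewrite (leq_trans (size_polyD _ _)) //.
  by rewrite geq_max size_homog_lhs size_inhomog.
have aP := proj2 (is_numeratorP a (numer a)) erefl.
by exists (numer a) => // m; rewrite (system_lhsE aP) E coef0.
Qed.

(** The coefficients u_n of U = R / Q^(M+1). *)
Definition sol_coef a : nat -> rat := conv (Rcheck a) (inv_pow M q M).

(** The differential operator of the system is the one that makes R = Q^(M+1) U
    a substitution: it becomes Q^(M+2) (2U - (1-4t) U'). *)
Lemma conv_ode a n :
  (- (1 - 4 *: 'X) * Q * (Rcheck a)^`()
   + (2 *: Q + (M * M.+1)%:R *: ((1 - 4 *: 'X) * 'X^(M - 1))) * Rcheck a)`_n =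
  conv (Q ^+ (M + 2))
    (fun m => (4 * m%:R + 2) * sol_coef a m - (m%:R + 1) * sol_coef a m.+1) n.
Proof.
set R := Rcheck a; set u := sol_coef a; pose W := Q ^+ M.+1.
have RE m : R`_m = conv W u m by rewrite /W /u /sol_coef conv_inv_powK.
pose du m := u m.+1 *+ m.+1.
have R'E m : R^`()`_m = conv W^`() u m + conv W du m.
  by rewrite coef_deriv RE conv_deriv.
have EA A : (A * R)`_n = conv (A * W) u n.
  by rewrite -conv_poly convM; apply: eq_conv => m _.
have EA' A : (A * R^`())`_n = conv (A * W^`()) u n + conv (A * W) du n.
  rewrite -conv_poly !convM -convDr; apply: eq_conv => m _; exact: R'E.
rewrite coefD EA EA' addrAC -convDl.
(* the terms with the derivative of W = Q^(M+1) cancel *)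
have -> : - (1 - 4 *: 'X) * Q * W^`() +
    (2 *: Q + (M * M.+1)%:R *: ((1 - 4 *: 'X) * 'X^(M - 1))) * W = Q ^+ (M + 2) * 2%:P.
  have dQ : Q^`() = M%:R * 'X^(M - 1).
    by rewrite /Q /Qpoly -/M derivB derivXn derivC subr0 subn1 mulr_natl.
  have NE p : (M * M.+1)%:R *: p = M%:R * M.+1%:R * p :> {poly rat}.
    by rewrite scaler_nat -natrM mulr_natl.
  rewrite /W deriv_exp dQ NE addn2 /= !exprS -[_ *+ M.+1]mulr_natl -!mul_polyC.
  by ring.
have -> : - (1 - 4 *: 'X) * Q * W = Q ^+ (M + 2) * (- (1 - 4 *: 'X)).
  by rewrite /W addn2 !exprS; ring.
rewrite !convM -convDr; apply: eq_conv => m _.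
have -> : - (1 - 4 *: 'X) = 4 *: ('X^1 - (4^-1)%:P) :> {poly rat}.
  by rewrite expr1 scalerBr scale_polyC divff // opprB.
rewrite convC convZl convXnC /du; case: m => [|m] /=.
  by rewrite -mulr_natr; field.
rewrite subSS subn0 -[_ *+ m.+2]mulr_natr -[_ *+ m.+1]mulr_natr.
by rewrite -[m.+2%:R]natr1; field.
Qed.

Lemma conv_inhomog n : conv (Q ^+ (M + 2)) pi_coef n = inhomog`_n.
Proof.
have D0 : quad`_0 != 0 by rewrite /quad !coefE.
have DF m : conv quad pi_coef m = (2 *: (3%:P - 2 *: 'X))`_m.
  have -> : quad = ('X^2 - (-2)%:P) + (-2) *: ('X^1 - 0%:P).
    by rewrite subr0 expr1 polyCN opprK scaleNr addrAC.
  rewrite convDl convZl !convXnC !coefE; case: m => [|[|m]] //.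
  by rewrite pi_coefSS !subSS !subn0; move: (pi_coef _) (pi_coef _) => x y /=; field.
apply: subr0_eq; move: n.
apply: (@conv_eq0 _ _ (fun n => conv (Q ^+ (M + 2)) pi_coef n - inhomog`_n) D0) => n.
rewrite convB -convM mulrC convM conv_poly quad_inhomog.
by rewrite [_ *: _ * _]mulrC -conv_poly (eq_conv _ (fun m _ => DF m)) subrr.
Qed.

(** Cancellation of the invertible series Q^(M+2) in the system. *)
Lemma coef_recurrence a (e : rat) n : homog_lhs a + e *: inhomog = 0 ->
  (n%:R + 1) * sol_coef a n.+1 = (4 * n%:R + 2) * sol_coef a n + e * pi_coef n - gen_seq a n.
Proof.
move=> E; apply: subr0_eq.
have Q0 : (Q ^+ (M + 2))`_0 != 0.
  rewrite -horner_coef0 horner_exp expf_neq0 // /Q /Qpoly hornerD hornerN.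
  by rewrite hornerXn hornerC expr0n /= (negPf (lt0n_neq0 Mpos)) sub0r oppr_eq0.
move: n; apply: (@conv_eq0 _ _ (fun n => (n%:R + 1) * sol_coef a n.+1 -
  ((4 * n%:R + 2) * sol_coef a n + e * pi_coef n - gen_seq a n)) Q0) => n.
have := congr1 (fun p : {poly rat} => - p`_n) E.
rewrite coef0 oppr0 /homog_lhs coefD coefB conv_ode.
rewrite coef_numer coefZ -conv_inhomog -convZ -convB -convDr => H.
rewrite -[RHS]H -mulN1r -convZ; apply: eq_conv => m _; ring.
Qed.

Definition sol_poly a i : {poly rat} := residue_poly M q M (Rcheck a) i.

Lemma Rcheck0 a : (Rcheck a)`_0 = 0.
Proof. by rewrite coef_Rcheck. Qed.

Lemma sol_coef_poly a i j : (0 < i <= M)%N ->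
  sol_coef a (M * j + i) = q ^- j * (sol_poly a i).[j%:R].
Proof. exact: residue_polyE Mpos q0 (Rcheck0 a) (size_Rcheck a). Qed.

Lemma sol_coef0 a : sol_coef a 0 = 0.
Proof. by rewrite /sol_coef /conv big_ord1 Rcheck0 mul0r. Qed.

Lemma sol_poly_last a : (sol_poly a M).[-1] = 0.
Proof. exact: residue_poly_last Mpos (size_Rcheck a). Qed.

(** The index M j belongs to the residue M with quotient j - 1; the formula
    persists for j = 0 because u_0 = 0 and g_M(-1) = 0. *)
Lemma sol_coef_mul a j : sol_coef a (M * j) = q ^- j * (q * (sol_poly a M).[j%:R - 1]).
Proof.
case: j => [|j].
  by rewrite muln0 sub0r sol_poly_last !mulr0 sol_coef0.
rewrite mulnS addnC sol_coef_poly ?Mpos ?leqnn // -natr1 addrK exprS; field.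
by rewrite expf_neq0 q0.
Qed.

Lemma pi_coef_quasi j i : pi_coef (M * j + i) = q ^- j * pi_coef i.
Proof. by rewrite /M -mulnA pi_coef_period exprM. Qed.

Lemma gen_seq_off a j i : (0 < i < M)%N -> gen_seq a (M * j + i) = 0.
Proof.
by move=> /andP[i0 iM]; rewrite /gen_seq (dvdn_addr _ (dvdn_mulr j (dvdnn M))) gtnNdvd.
Qed.

Lemma gen_seq_mul a j :
  gen_seq a (M * j) = q ^- j * ((2 * (M%:R * j%:R) + 1) * (Spoly a).[j%:R]).
Proof.
rewrite gen_seqE dvdn_mulr // mulKn // hornerM hornerD hornerZ hornerX hornerC.
by rewrite mulrA.
Qed.

Lemma poly_eq_nat (p r : {poly rat}) :
  (forall n : nat, p.[n%:R] = r.[n%:R]) -> p = r.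
Proof.
move=> pr; apply: subr0_eq; apply: poly_nat_eq0 => n.
by rewrite hornerD hornerN pr subrr.
Qed.

Lemma sol_poly_step a e i x : homog_lhs a + e *: inhomog = 0 -> (0 < i < M)%N ->
  (M%:R * x + i%:R + 1) * (sol_poly a i.+1).[x] =
  2 * (2 * (M%:R * x + i%:R) + 1) * (sol_poly a i).[x] + e * pi_coef i.
Proof.
move=> E iM; have : (M%:R *: 'X + (i%:R + 1)%:P) * sol_poly a i.+1 =
    ((4 * M%:R) *: 'X + (4 * i%:R + 2)%:P) * sol_poly a i + (e * pi_coef i)%:P.
  apply: poly_eq_nat => n; have := coef_recurrence (M * n + i) E.
  rewrite gen_seq_off // -addnS pi_coef_quasi !sol_coef_poly; [|lia|lia].
  rewrite !(hornerD, hornerM, hornerZ, hornerX, hornerC) natrD natrM => H.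
  have qn : q ^- n != 0 by rewrite invr_neq0 ?expf_neq0.
  apply: (mulfI qn); apply: etrans (etrans H _); ring.
move=> /(congr1 (fun p : {poly rat} => p.[x])).
rewrite !(hornerD, hornerM, hornerZ, hornerX, hornerC) addrA => ->; ring.
Qed.

Lemma sol_poly_wrap a e x : homog_lhs a + e *: inhomog = 0 ->
  (M%:R * x + 1) * (sol_poly a 1).[x] =
  2 * (2 * (M%:R * x) + 1) * q * (sol_poly a M).[x - 1] + e * pi_coef 0
  - (2 * (M%:R * x) + 1) * (Spoly a).[x].
Proof.
move=> E; have : (M%:R *: 'X + 1%:P) * sol_poly a 1 = ((4 * M%:R * q) *: 'X + (2 * q)%:P) *
     (sol_poly a M \Po ('X + (-1)%:P)) + (e * pi_coef 0)%:P - ((2 * M%:R) *: 'X + 1%:P) * Spoly a.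
  apply: poly_eq_nat => n; have := coef_recurrence (M * n) E.
  rewrite gen_seq_mul sol_coef_mul -addn1 sol_coef_poly; last by rewrite Mpos.
  have -> : pi_coef (M * n) = q ^- n * pi_coef 0 by rewrite -pi_coef_quasi addn0.
  rewrite !(hornerD, hornerN, hornerM, horner_shift, hornerZ, hornerX, hornerC).
  rewrite natrM => H; have qn : q ^- n != 0 by rewrite invr_neq0 ?expf_neq0.
  apply: (mulfI qn); apply: etrans (etrans H _); ring.
move=> /(congr1 (fun p : {poly rat} => p.[x])).
rewrite !(hornerD, hornerN, hornerM, horner_shift, hornerZ, hornerX, hornerC) => ->; ring.
Qed.

Lemma size_sol_poly a i : (size (sol_poly a i) <= M.+1)%N.
Proof. exact: size_residue_poly. Qed.

Lemma size_Spoly_solution a : homog_lhs a + inhomog = 0 -> size (Spoly a) = M.+1.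
Proof.
rewrite -[inhomog]scale1r => E; apply/eqP; rewrite eqn_leq size_Spoly.
apply: (@size_S_gt k (sol_poly a) (Spoly a) 1 k0) => //.
- by move=> i _; apply: size_sol_poly.
- exact: sol_poly_last.
- by move=> i x iM; apply: sol_poly_step.
- by move=> x; apply: sol_poly_wrap.
Qed.

Lemma homog_lhs_inj a : homog_lhs a = 0 -> Rcheck a = 0 /\ Spoly a = 0.
Proof.
move=> E0; have E : homog_lhs a + 0 *: inhomog = 0 by rewrite scale0r addr0.
have [g0 S0] : (forall i, (0 < i <= M)%N -> sol_poly a i = 0) /\ Spoly a = 0.
  apply: (@homogeneous_eq0 k (sol_poly a) (Spoly a) 0 k0) => //.
  - by move=> i _; apply: size_sol_poly.
  - exact: sol_poly_last.
  - by move=> i x iM; apply: sol_poly_step.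
  - by move=> x; apply: sol_poly_wrap.
split=> //; apply/polyP => n; rewrite coef0.
rewrite -(@conv_inv_powK _ M q M (Rcheck a) n Mpos q0).
transitivity (conv (Q ^+ M.+1) (fun=> 0) n); last first.
  by rewrite /conv big1 // => i _; rewrite mulr0.
apply: eq_conv => -[|m] _; first exact: sol_coef0.
rewrite -/(sol_coef a _) (divn_eq m M) -addnS mulnC sol_coef_poly ?g0 ?horner0 ?mulr0 //=.
  by rewrite ltn_pmod.
by rewrite ltn_pmod.
Qed.

Lemma unknowns_eq0 a : Rcheck a = 0 -> Spoly a = 0 -> forall i, tnth a i = 0.
Proof.
move=> R0 S0 i; rewrite (tnth_nth 0) -/(unknown a i.+1).
have [iN|Ni] := ltnP i.+1 (Nk k).
  by have := coef_Rcheck a i.+1; rewrite R0 coef0 iN.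
have := coef_Spoly a (i.+1 - Nk k); rewrite S0 coef0 subnKC // => H.
by rewrite ifT in H => //; have := ltn_ord i; rewrite /M; lia.
Qed.

Definition lin_comb (x : rat) a b : unknowns k :=
  [tuple x * tnth a i + tnth b i | i < Nk k + 4 * k].

Lemma unknown_lin_comb x a b j :
  unknown (lin_comb x a b) j = x * unknown a j + unknown b j.
Proof.
rewrite /unknown; have [jn|nj] := ltnP j.-1 (Nk k + 4 * k).
  rewrite -[j.-1]/(nat_of_ord (Ordinal jn)) -!tnth_nth tnth_mktuple //.
by rewrite !nth_default ?size_tuple // mulr0 addr0.
Qed.

Lemma Rcheck_lin_comb x a b :
  Rcheck (lin_comb x a b) = x *: Rcheck a + Rcheck b.
Proof.
apply/polyP => i; rewrite coefD coefZ !coef_Rcheck unknown_lin_comb.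
by case: ifP; rewrite ?mulr0 ?addr0.
Qed.

Lemma Spoly_lin_comb x a b : Spoly (lin_comb x a b) = x *: Spoly a + Spoly b.
Proof.
apply/polyP => i; rewrite coefD coefZ !coef_Spoly unknown_lin_comb.
by case: ifP; rewrite ?mulr0 ?addr0.
Qed.

Lemma homog_lhs_lin_comb x a b :
  homog_lhs (lin_comb x a b) = x *: homog_lhs a + homog_lhs b.
Proof.
have -> : homog_lhs (lin_comb x a b) = x *: (homog_lhs a + numer a) +
    (homog_lhs b + numer b) - numer (lin_comb x a b).
  rewrite /homog_lhs !subrK Rcheck_lin_comb derivD derivZ.
  move: (- (1 - 4 *: 'X) * Q) (2 *: Q + _) => A B.
  rewrite !mulrDr -!scalerAr scalerDr; congr (_ - _); exact: addrACA.
have -> : numer (lin_comb x a b) = x *: numer a + numer b.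
  apply/polyP => m; rewrite coefD coefZ !coef_numer -convZ -convDr.
  apply: eq_conv => n _; rewrite !gen_seqE; case: ifP => _; last by rewrite mulr0 addr0.
  rewrite Spoly_lin_comb; move: (_ *: 'X + _) => L.
  by rewrite !hornerM hornerD hornerZ; ring.
by rewrite scalerDr [_ + _ + (_ + numer b)]addrACA addrK.
Qed.

(** The linear map from the N(k)+4k unknowns to the N(k)+4k coefficients is
    injective, hence bijective. *)
Lemma solution_exists : exists a, homog_lhs a + inhomog = 0.
Proof.
pose n := (Nk k + 4 * k)%N.
pose tup (v : 'rV[rat]_n) : unknowns k := [tuple v 0 i | i < n].
pose f (v : 'rV[rat]_n) : 'rV[rat]_n := \row_i (homog_lhs (tup v))`_i.
have f_lin : linear f.
  move=> x v w; apply/rowP => i; rewrite !mxE -coefZ -coefD -homog_lhs_lin_comb.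
  congr ((homog_lhs _)`_i); apply: eq_from_tnth => j.
  by rewrite !tnth_mktuple !mxE.
pose fL : {linear 'rV[rat]_n -> 'rV[rat]_n} :=
  HB.pack f (GRing.isLinear.Build _ _ _ _ f f_lin).
pose A := lin1_mx fL.
have Au : A \in unitmx.
  rewrite -row_free_unit -kermx_eq0; apply/eqP/row_matrixP => i; rewrite row0.
  have : row i (kermx A) *m A = 0 by rewrite -row_mul mulmx_ker row0.
  rewrite mul_rV_lin1 /= => fv0; set v := row i (kermx A) in fv0 *.
  have h0 : homog_lhs (tup v) = 0.
    apply/polyP => m; rewrite coef0; have [mn|nm] := ltnP m n.
      by have := congr1 (fun u : 'rV_n => u 0 (Ordinal mn)) fv0; rewrite !mxE.
    by rewrite nth_default // (leq_trans (size_homog_lhs _)).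
  have [R0 S0] := homog_lhs_inj h0; apply/rowP => j.
  by rewrite [RHS]mxE -(unknowns_eq0 R0 S0 j) tnth_mktuple.
pose c : 'rV[rat]_n := \row_i (- inhomog`_i).
exists (tup (c *m invmx A)); apply/polyP => m; rewrite coef0 coefD.
have [mn|nm] := ltnP m n; last first.
  rewrite [(homog_lhs _)`_m]nth_default ?(leq_trans (size_homog_lhs _)) // add0r.
  by rewrite nth_default // (leq_trans size_inhomog).
have : c *m invmx A *m A = c by rewrite mulmxKV.
rewrite mul_rV_lin1 /= => /(congr1 (fun u : 'rV_n => u 0 (Ordinal mn))).
by rewrite !mxE => ->; rewrite addNr.
Qed.

Lemma solution_Spoly_unique a b : homog_lhs a + inhomog = 0 ->
  homog_lhs b + inhomog = 0 -> Spoly a = Spoly b.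
Proof.
move=> ha hb; have [|_] := @homog_lhs_inj (lin_comb (-1) b a).
  rewrite homog_lhs_lin_comb scaleN1r addrC.
  by rewrite -(addrKA inhomog) ha [inhomog + _]addrC hb subrr.
by rewrite Spoly_lin_comb scaleN1r addrC => /subr0_eq.
Qed.

(** The right-hand side, with L in place of M J, increases by p_L I_L when L
    grows by 1, and p_L I_L is a term on the left for L = M j and 0 for the
    other L. *)
Lemma telescoping a J : homog_lhs a + inhomog = 0 ->
  \sum_(j < J) (Spoly a).[j%:R] / ('C((M * j).*2, M * j)%:R * q ^+ j) =
  \sum_(n < M * J) pi_coef n * beta_int rat n
  - 2 * sol_coef a (M * J) / 'C((M * J).*2, M * J)%:R.
Proof.
move=> ha; pose E L := \sum_(n < L) pi_coef n * beta_int rat n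
  - 2 * sol_coef a L / 'C(L.*2, L)%:R.
have ES L : E L.+1 = E L + gen_seq a L * beta_int rat L.
  have := @coef_recurrence a 1 L; rewrite scale1r mul1r => /(_ ha) H.
  rewrite /E big_ord_recr /= /beta_int central_binS.
  have o := odd_neq0 rat L; have c := central_bin_neq0 rat L.
  have l : L%:R + 1 != 0 :> rat by rewrite natr1 pnatr_eq0.
  have -> : sol_coef a L.+1 = ((4 * L%:R + 2) * sol_coef a L + pi_coef L - gen_seq a L) / (L%:R + 1).
    by rewrite -H mulrC mulKf.
  by field; rewrite o c l.
rewrite -/(E (M * J)%N); elim: J => [|J IHJ].
  by rewrite /E muln0 !big_ord0 sol_coef0 mulr0 mul0r subr0.
rewrite big_ord_recr /= IHJ.
have En i : (0 < i <= M)%N -> E (M * J + i)%N =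
    E (M * J)%N + gen_seq a (M * J) * beta_int rat (M * J).
  elim: i => // i IHi iM; rewrite addnS ES; case: (posnP i) => [->|i0].
    by rewrite addn0.
  by rewrite IHi ?gen_seq_off ?mul0r ?addr0 //; lia.
rewrite mulnS addnC En ?Mpos ?leqnn //; congr (_ + _).
rewrite gen_seq_mul /beta_int natrM; field.
have := odd_neq0 rat (M * J); rewrite natrM => ->.
by rewrite central_bin_neq0 expf_neq0 ?q0.
Qed.

(** Here u_(MJ) = q^(1-J) g_M(J-1), the polynomial g_M of degree at most M is
    bounded by a multiple of 2^(MJ), which C(2MJ,MJ) compensates, and the factor
    q^-J remains. *)
Lemma sol_coef_bound a : exists C : rat, forall J : nat,
  `|sol_coef a (M * J) / 'C((M * J).*2, M * J)%:R| <= C / 4 ^+ J.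
Proof.
exists (4 ^+ k * \sum_(i < M.+1) `|(sol_poly a M)`_i|) => J; rewrite sol_coef_mul.
set n := (M * J)%N; set g := sol_poly a M; set C := \sum_(i < _) _.
have normq : `|q| = 4 ^+ k by rewrite /q normrX normrN ger0_norm.
have x1 : `|J%:R - 1| <= 2 ^+ J :> rat.
  have JJ : J.+1%:R <= 2 ^+ J :> rat by rewrite -natrX ler_nat ltn_expl.
  apply: le_trans JJ; rewrite -natr1 (le_trans (ler_normB _ _)) // normr1.
  by rewrite lerD2r ger0_norm.
have gb : `|g.[J%:R - 1]| <= C * 2 ^+ n.
  rewrite (horner_coef_wide _ (size_sol_poly a M)) (le_trans (ler_norm_sum _ _ _)) //.
  rewrite mulr_suml; apply: ler_sum => i _; rewrite normrM ler_wpM2l //.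
  rewrite normrX (le_trans (lerXn2r i _ _ x1)) ?nnegrE ?exprn_ge0 //.
  rewrite -exprM ler_eXn2l ?ler1n // /n mulnC leq_mul2r.
  by rewrite -ltnS ltn_ord orbT.
have Cb : 2 ^+ n <= 'C(n.*2, n)%:R :> rat by rewrite -natrX ler_nat central_bin_ge.
have C0 : 0 <= C by apply: sumr_ge0.
have p2 : 0 < 2 ^+ n :> rat by apply: exprn_gt0.
rewrite normrM normfV normr_nat normrM normrM normfV normrX normq.
rewrite ler_pdivrMr ?(lt_le_trans p2) //.
have qJ : (4 ^+ k ^+ J)^-1 <= (4 ^+ J)^-1 :> rat.
  rewrite lef_pV2 ?posrE ?exprn_gt0 // -exprM ler_eXn2l ?ler1n //.
  by rewrite leq_pmull.
apply: (@le_trans _ _ ((4 ^+ J)^-1 * (4 ^+ k * (C * 2 ^+ n)))).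
  rewrite ler_pM // ?mulr_ge0 ?invr_ge0 ?exprn_ge0 //.
  by rewrite ler_wpM2l ?exprn_ge0.
rewrite [leLHS]mulrC mulrA mulrAC ler_wpM2l // mulr_ge0 ?invr_ge0 ?exprn_ge0 //.
by rewrite mulr_ge0 ?exprn_ge0.
Qed.

End System.

(** * The series for pi *)

Lemma pi_coef_bound n : `|pi_coef n| <= 3 * 2 ^+ n.
Proof.
elim/ltn_ind: n => -[|[|n]] IHn; [by rewrite expr0|by rewrite expr1|].
rewrite pi_coefSS (le_trans (ler_normB _ _)) // normrM.
have := IHn n.+1 (ltnSn _); have := IHn n (leqW (ltnSn _)).
have -> : `|2^-1| = 2^-1 :> rat by rewrite ger0_norm.
rewrite !exprS.
have : 0 <= 2 ^+ n :> rat by rewrite exprn_ge0.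
lra.
Qed.

Section PiSeries.
Variable R : realType.

Let coefR n : R := ratr (pi_coef n).

Lemma coefR_bound n : `|coefR n| <= 3 * 2 ^+ n.
Proof.
rewrite /coefR -ratr_norm (_ : 3 * 2 ^+ n = ratr (3 * 2 ^+ n)).
  by rewrite ler_rat pi_coef_bound.
by rewrite rmorphM rmorphXn /= !rmorph_nat.
Qed.

(** A primitive of (x(1-x))^n, by partial integration; the derivative of
    (1-2x) t^(n+1) is (n+1) t^n - (4n+6) t^(n+1) for t = x(1-x). *)
Fixpoint beta_prim n : {poly R} :=
  match n with
  | 0 => 'X
  | m.+1 => (4 * m%:R + 6)^-1 *:
      ((m%:R + 1) *: beta_prim m - (1 - 2 *: 'X) * ('X * (1 - 'X)) ^+ m.+1)
  end.

Lemma den_neq0 m : 4 * m%:R + 6 != 0 :> R.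
Proof. by rewrite -natrM -natrD addnS pnatr_eq0. Qed.

Lemma deriv_beta_prim n : (beta_prim n)^`() = ('X * (1 - 'X)) ^+ n.
Proof.
elim: n => [|n IHn] /=; first by rewrite derivX.
rewrite derivZ derivB derivZ IHn derivM deriv_exp derivM !derivB derivZ !derivX.
rewrite -polyC1 !derivC /= exprS.
set t := ('X * _) ^+ n.
have -> : ((n%:R + 1) *: t -
   ((0 - 2 *: 1%:P) * ('X * (1%:P - 'X) * t) +
    (1%:P - 2 *: 'X) * ((1%:P * (1%:P - 'X) + 'X * (0 - 1%:P)) * t *+ n.+1))) =
   (4 * n%:R + 6) *: ('X * (1%:P - 'X) * t).
  rewrite -[_ *+ n.+1]mulr_natl -[n.+1%:R]natr1 -!mul_polyC.
  rewrite !rmorphD !rmorphM /= !rmorph_nat; ring.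
by rewrite scalerA mulVf ?den_neq0 // scale1r.
Qed.

Lemma beta_prim_diff n : (beta_prim n).[1] - (beta_prim n).[0] = beta_int R n.
Proof.
elim: n => [|n IHn] /=; first by rewrite !hornerX subr0 beta_int0.
rewrite !hornerZ !hornerD !hornerN !hornerM !horner_exp !hornerM !hornerZ.
rewrite !hornerD !hornerN !hornerX !hornerC subrr !mulr0 mul0r expr0n /= !mulr0 !subr0.
by rewrite beta_intS -IHn; field; rewrite den_neq0.
Qed.

Lemma pi_coef_remainder L (t : R) :
  (t ^+ 2 - 2 * t + 2) * (\sum_(n < L) coefR n * t ^+ n) =
  6 - 4 * t - t ^+ L * (2 * coefR L - t * (2 * coefR L - 2 * coefR L.+1)).
Proof.
elim: L => [|L IHL].
  by rewrite big_ord0 /coefR (_ : pi_coef 0 = 3) // (_ : pi_coef 1 = 1) // !rmorph_nat; ring.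
rewrite big_ord_recr /= mulrDr IHL /coefR pi_coefSS rmorphB fmorph_div /= rmorph_nat.
by rewrite [t ^+ L.+1]exprS; field.
Qed.

(** The function 2 atan x - 2 atan (1-x) is a primitive of F(x(1-x)) and grows by
    pi on [0,1].  The difference with the primitive of a partial sum has the
    remainder of [pi_coef_remainder] as derivative; it is small because t <= 1/4
    while the F_n grow at most like 2^n, and the mean value theorem applies. *)
Lemma pi_series_bound L :
  `|pi - \sum_(n < L) coefR n * beta_int R n| <= 12 / 2 ^+ L.
Proof.
pose G := \sum_(n < L) coefR n *: beta_prim n.
pose t_of (x : R) : R := x * (1 - x).
pose df (x : R) : R := 2 * (1 + x ^+ 2)^-1 + 2 * (1 + (1 - x) ^+ 2)^-1
   - \sum_(n < L) coefR n * t_of x ^+ n.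
have dG x : G^`().[x] = \sum_(n < L) coefR n * t_of x ^+ n.
  rewrite /G raddf_sum horner_sum; apply: eq_bigr => n _ /=.
  rewrite derivZ deriv_beta_prim hornerZ horner_exp hornerM hornerD hornerN.
  by rewrite !hornerX hornerC.
have horner_refl (x : R) : (1 - 'X).[x] = 1 - x by rewrite hornerD hornerN hornerX hornerC.
pose f : R -> R := 2 \*: atan - 2 \*: (atan \o horner (1 - 'X)) - horner G.
have fdf (x : R) : is_derive x (1 : R) f (df x).
  have da : is_derive (1 - 'X).[x] (1 : R) (@atan R) (1 + (1 - x) ^+ 2)^-1.
    by rewrite -(horner_refl x); apply: is_derive1_atan.
  apply: is_derive_eq.
  rewrite dG derivB derivX -polyC1 derivC sub0r hornerN hornerC mulrN1.
  by rewrite scalerN opprK.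
have fcont : {within `[0, 1], continuous f}%classic.
  by apply: derivable_within_continuous => x _; case: (fdf x).
have [c c01] := MVT ltr01 (fun x _ => fdf x) fcont.
have -> : f 1 - f 0 = pi - \sum_(n < L) coefR n * beta_int R n.
  have fE x : f x = 2 * atan x - 2 * atan (1 - x) - G.[x].
    by rewrite /f -horner_refl.
  have GE : G.[1] - G.[0] = \sum_(n < L) coefR n * beta_int R n.
    rewrite /G !horner_sum -sumrB; apply: eq_bigr => n _.
    by rewrite !hornerZ -mulrBr beta_prim_diff.
  by rewrite !fE subrr subr0 -GE atan0 atan1; field.
rewrite subr0 mulr1 => ->.
have [c0 c1] : 0 < c /\ c < 1 by move: c01; rewrite in_itv => /andP.
have t0 : 0 <= t_of c by rewrite mulr_ge0 ?subr_ge0 ?ltW.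
have t4 : t_of c <= 4^-1.
  rewrite -subr_ge0 (_ : _ - _ = (c - 2^-1) ^+ 2) ?sqr_ge0 //.
  by rewrite /t_of; field.
have D1 : 1 <= t_of c ^+ 2 - 2 * t_of c + 2.
  by rewrite (_ : _ + 2 = (t_of c - 1) ^+ 2 + 1) ?lerDr ?sqr_ge0 //; ring.
have dfE : (t_of c ^+ 2 - 2 * t_of c + 2) * df c =
    t_of c ^+ L * (2 * coefR L - t_of c * (2 * coefR L - 2 * coefR L.+1)).
  have c2 : 1 + c ^+ 2 != 0 by rewrite gt_eqF // ltr_pwDl // sqr_ge0.
  have c2' : 1 + (1 - c) ^+ 2 != 0 by rewrite gt_eqF // ltr_pwDl // sqr_ge0.
  rewrite /df mulrBr pi_coef_remainder.
  have -> : (t_of c ^+ 2 - 2 * t_of c + 2) * (2 / (1 + c ^+ 2) + 2 / (1 + (1 - c) ^+ 2)) =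
    6 - 4 * t_of c.
    by rewrite /t_of; field; rewrite c2 c2'.
  by ring.
have b0 := coefR_bound L; have b1 := coefR_bound L.+1.
have p2 : 0 < 2 ^+ L :> R by rewrite exprn_gt0.
have le1 : `|df c| <= `|(t_of c ^+ 2 - 2 * t_of c + 2) * df c|.
  by rewrite normrM ler_peMl // (le_trans D1) ?ler_norm.
apply: (le_trans le1); rewrite dfE normrM normrX (ger0_norm t0).
have tL : t_of c ^+ L <= (4 ^+ L)^-1 by rewrite -exprVn lerXn2r ?nnegrE ?invr_ge0.
have B : `|2 * coefR L - t_of c * (2 * coefR L - 2 * coefR L.+1)| <= 12 * 2 ^+ L.
  rewrite exprS in b1; move: (coefR L) (coefR L.+1) (t_of c) t0 t4 b0 b1 => x y t t0 t4 bx b_y.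
  rewrite (le_trans (ler_normB _ _)) // !normrM (ger0_norm t0).
  have := ler_normB (2 * x) (2 * y); have := normr_ge0 (2 * x - 2 * y).
  rewrite !normrM (ger0_norm (ler0n _ 2)); move: `|2 * x - 2 * y| => z z0 zle.
  have : t * z <= 4^-1 * z by rewrite ler_wpM2r.
  lra.
apply: (@le_trans _ _ ((4 ^+ L)^-1 * (12 * 2 ^+ L))).
  by rewrite ler_pM // exprn_ge0.
rewrite (_ : 4 = 2 * 2); last by ring.
rewrite exprMn le_eqVlt; apply/orP; left; apply/eqP; field.
by rewrite gt_eqF.
Qed.

End PiSeries.

Lemma cvg_geometric_bound (R : realType) (u : nat -> R) (l C : R) :
  (forall n, `|l - u n| <= C / 2 ^+ n) -> u @ \oo --> l.
Proof.
move=> ub; apply: (@squeeze_cvgr _ _ _ _ (fun n => l - C / 2 ^+ n)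
    (fun n => l + C / 2 ^+ n)).
- near=> n; have := ub n; rewrite ler_distl => /andP[h1 h2].
  by rewrite lerBlDr h2 /= -lerBlDr h1.
- rewrite -[X in _ --> X]subr0; apply: cvgB; first exact: cvg_cst.
  under eq_fun => n do rewrite -exprVn.
  by apply: cvg_geometric; rewrite ger0_norm // invf_lt1 // ltr1n.
- rewrite -[X in _ --> X]addr0; apply: cvgD; first exact: cvg_cst.
  under eq_fun => n do rewrite -exprVn.
  by apply: cvg_geometric; rewrite ger0_norm // invf_lt1 // ltr1n.
Unshelve. all: by end_near.
Qed.

Theorem theorem8 (R : realType) (k : nat) (hk : (1 <= k)%N) :
  exists S : {poly rat},
    [/\ size S = (4 * k).+1,
        series (fun n : nat =>
          ratr S.[n%:R] / ('C(8 * k * n, 4 * k * n)%:R * (- 4) ^+ (k * n)) : R)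
          @ \oo --> (pi : R),
        exists a : unknowns k, solves_L a
      & forall a : unknowns k, solves_L a -> Spoly a = S].
Proof.
have [a ha] := solution_exists hk; exists (Spoly a); split.
- exact: size_Spoly_solution ha.
- have [C uC] := sol_coef_bound hk a.
  apply: (@cvg_geometric_bound _ _ _ (12 + 2 * ratr C)) => J.
  set M := (4 * k)%N; pose v := sol_coef a (M * J) / 'C((M * J).*2, M * J)%:R.
  have bE n : beta_int R n = ratr (beta_int rat n).
    by rewrite /beta_int fmorphV rmorphM rmorphD rmorphM rmorph1 !rmorph_nat.
  have -> : series (fun n : nat => ratr (Spoly a).[n%:R] /
      ('C(8 * k * n, 4 * k * n)%:R * (- 4) ^+ (k * n)) : R) J =
      \sum_(n < M * J) ratr (pi_coef n) * beta_int R n - 2 * ratr v.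
    transitivity (ratr (\sum_(j < J) (Spoly a).[j%:R] /
        ('C((M * j).*2, M * j)%:R * ((- 4) ^+ k) ^+ j)) : R).
      rewrite /series /= big_mkord rmorph_sum; apply: eq_bigr => j _.
      rewrite fmorph_div rmorphM /= rmorph_nat -exprM rmorphXn /= rmorphN rmorph_nat.
      by rewrite -mul2n !mulnA.
    rewrite (telescoping hk J ha) -mulrA rmorphB rmorphM rmorph_nat rmorph_sum.
    by congr (_ - _); apply: eq_bigr => n _; rewrite rmorphM bE.
  rewrite opprB addrCA addrC.
  apply: le_trans (ler_normD _ _) _; rewrite [leRHS]mulrDl; apply: lerD.
    rewrite (le_trans (pi_series_bound _ _)) // ler_wpM2l // lef_pV2 ?posrE ?exprn_gt0 //.
    by rewrite ler_eXn2l ?ltr1n // leq_pmull // muln_gt0.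
  rewrite normrM ger0_norm // -mulrA ler_wpM2l // -ratr_norm.
  have h : `|v| <= C / 2 ^+ J.
    have C0 : 0 <= C by have := uC 0%N; rewrite expr0 divr1; apply: le_trans.
    rewrite (le_trans (uC J)) // ler_wpM2l // lef_pV2 ?posrE ?exprn_gt0 //.
    by rewrite lerXn2r ?nnegrE.
  have := h; rewrite -(ler_rat R) => /le_trans; apply.
  by rewrite fmorph_div rmorphXn rmorph_nat.
- by exists a; apply/solves_LP.
by move=> b /(solves_LP hk) hb; apply: solution_Spoly_unique hb ha.
Qed.
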